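(* If the signal model and likelihood models $\{f_k,L_k(\cdot|\theta)\}$ are identical for all agents $k\in\mathcal N$, then the uniform vector $\frac1N\mathbb 1=(1/N,\dots,1/N)$ is the unique optimal solution of the error exponent maximization problem $\max_{\pi\in\Pi}\Phi(\pi)$. The corresponding optimal error exponent is $N$ times the non-cooperative one: $\Phi^\star=\Phi^{\mathsf{nc}}_\Sigma(\theta^\dagger)=N\,\Phi_k^{\mathsf{nc}}(\theta^\dagger)$ (for any $k\in\mathcal N$), where $\Phi^\star=\max_{\pi\in\Pi}\Phi(\pi)$.
   Context: There are $N$ agents $\mathcal N=\{1,\dots,N\}$ and a hypothesis set $\Theta=\{\theta_1,\dots,\theta_H\}$ with true state $\theta_1$. At each time $i=1,2,\dots$ agent $k$ receives a signal $\xi_{k,i}\in\mathcal X_k$ with distribution $f_k$ (a pdf or pmf); the signals are independent over agents and over time. Agent $k$ has likelihood models $L_k(\cdot|\theta)$, $\theta\in\Theta$ (pdfs or pmfs, of the same type as $f_k$), with the same support $\mathcal X_k$ as $f_k$; $f_k$ need not equal any $L_k(\cdot|\theta)$. Put $x_{k,i}(\theta)=\log\frac{L_k(\xi_{k,i}|\theta_1)}{L_k(\xi_{k,i}|\theta)}$, $d_k(\theta)=\mathbb E[x_{k,i}(\theta)]=D_{\mathrm{KL}}(f_k\|L_k(\cdot|\theta))-D_{\mathrm{KL}}(f_k\|L_k(\cdot|\theta_1))$, and $\Lambda_k(t;\theta)=\log\mathbb E[e^{tx_{k,i}(\theta)}]$, with expectations with respect to $f_k$. Standing assumptions: all $D_{\mathrm{KL}}(f_k\|L_k(\cdot|\theta))$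 are finite; $\Lambda_k(t;\theta)<\infty$ for all $t\in\mathbb R$, $k\in\mathcal N$, $\theta\ne\theta_1$; identifiability: with $\Theta_k^\star=\arg\min_{\theta\in\Theta}D_{\mathrm{KL}}(f_k\|L_k(\cdot|\theta))$ and the (nonempty) set $\mathcal N_A=\{k:\theta_1\in\Theta_k^\star\}$, one has $\bigcap_{k\in\mathcal N_A}\Theta_k^\star=\{\theta_1\}$. The set of feasible Perron eigenvectors is $$\Pi=\Big\{\pi\in\mathbb R^N:\ \textstyle\sum_k\pi_k=1,\ \pi_k>0\ \forall k,\ \ \sum_{k=1}^N\pi_kd_k(\theta)>0\ \ \forall\theta\neq\theta_1\Big\}.$$ For $\pi\in\Pi$ and $\theta\ne\theta_1$ put $\Lambda_{\mathsf{ave}}(t;\pi,\theta)=\sum_{k=1}^N\Lambda_k(\pi_kt;\theta)$, $\phi(t;\pi,\theta)=\int_0^t\frac{\Lambda_{\mathsf{ave}}(\tau;\pi,\theta)}{\tau}d\tau$ (integrand extended by continuity at $0$), $\Phi(\pi,\theta)=-\inf_{t\in\mathbb R}\phi(t;\pi,\theta)$ and $\Phi(\pi)=\min_{\theta\ne\theta_1}\Phi(\pi,\theta)$. The non-cooperative error exponent of agent $k$ is $\Phi_k^{\mathsf{nc}}(\theta)=-\lim_{\delta\to0}\delta\ln\mathbb P\big[\delta\sum_{m=0}^\infty(1-\delta)^mx_{k,m+1}(\theta)\le0\big]$; it equals $-\inf_{t\in\mathbb R}\int_0^t\frac{\Lambda_k(\tau;\theta)}{\tau}d\tau$ if $d_k(\theta)>0$,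 and $0$ if $d_k(\theta)\le 0$ or $\Lambda_k(\cdot;\theta)\equiv0$. Put $\Phi^{\mathsf{nc}}_\Sigma(\theta)=\sum_{k=1}^N\Phi_k^{\mathsf{nc}}(\theta)$ and $\theta^\dagger=\arg\min_{\theta\ne\theta_1}\Phi^{\mathsf{nc}}_\Sigma(\theta)$, where it is assumed that this minimizer is unique. *)

(* Defs.v *)
From HB Require Import structures.
From mathcomp Require Import all_boot all_order all_algebra.
From mathcomp Require Import all_classical all_reals all_analysis.

Set Implicit Arguments.
Unset Strict Implicit.
Unset Printing Implicit Defensive.

Import Order.TTheory GRing.Theory Num.Theory.
Import numFieldNormedType.Exports.

Local Open Scope classical_set_scope.
Local Open Scope ring_scope.

Section optimizers.
Context {R : realType} {A : Type}.
Implicit Types (S : set A) (F : A -> \bar R).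

Definition argmin S F : set A :=
  [set a | S a /\ forall b, S b -> (F a <= F b)%E].

Definition argmax S F : set A :=
  [set a | S a /\ forall b, S b -> (F b <= F a)%E].

End optimizers.

Section densities.
Context {R : realType} {d : measure_display} {T : measurableType d}.
Variable mu : set T -> \bar R.
Implicit Types (f g : T -> R) (X : set T).

(* [mu] is Lebesgue measure for a pdf and the counting measure for a pmf. *)
Definition is_density f : Prop :=
  [/\ measurable_fun setT f, forall x, 0 <= f x
    & (\int[mu]_x (f x)%:E = 1)%E].

(* Supports matter only up to [mu]-null sets, as densities do. *)
Definition has_support f X : Prop := \forall x \ae mu, X x <-> 0 < f x.

Definition expect f (u : T -> R) : \bar R := (\int[mu]_x (u x * f x)%:E)%E.

Definition KL f g : \bar R := expect f (fun x => ln (f x / g x)).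

End densities.

(* The product rule over every finite subfamily. *)
Definition mutually_independent {R : realType} {d d' : measure_display}
    {Omega : measurableType d} {T : measurableType d'} {I : choiceType}
    (P : probability Omega R) (Y : I -> Omega -> T) : Prop :=
  forall (s : seq I) (B : I -> set T),
    uniq s -> (forall i, measurable (B i)) ->
    P (\bigcap_(i in [set` s]) (Y i @^-1` B i)) =
    (\prod_(i <- s) P (Y i @^-1` B i))%E.

(* [\int_a^b], also for [b < a]. *)
Definition oriented_integral {R : realType} (g : R -> R) (a b : R) : R :=
  if a <= b then \int[lebesgue_measure]_(s in `[a, b]) g s
  else - \int[lebesgue_measure]_(s in `[b, a]) g s.

(* [s |-> h s / s], extended to [s = 0] by its limit there. *)
Definition quotient_ext {R : realType} (h : R -> R) (s : R) : R :=
  if s == 0 then lim (h u / u @[u --> 0^']) else h s / s.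

Section model.
Context {R : realType} {d : measure_display} {T : measurableType d}.
Context {N : nat} {Theta : finType}.
Variable mu : {sigma_finite_measure set T -> \bar R}.
Variable f : 'I_N -> T -> R.
Variable L : 'I_N -> Theta -> T -> R.
Variable theta1 : Theta.

(* [x_{k,i}(theta)] as a function of the signal value. *)
Definition llr (k : 'I_N) (theta : Theta) (x : T) : R :=
  ln (L k theta1 x / L k theta x).

Definition mean_llr (k : 'I_N) (theta : Theta) : R :=
  fine (expect mu (f k) (llr k theta)).

Definition mgf (k : 'I_N) (t : R) (theta : Theta) : \bar R :=
  expect mu (f k) (fun x => expR (t * llr k theta x)).

(* [fine] loses nothing where [mgf] is finite. *)
Definition Lambda (k : 'I_N) (t : R) (theta : Theta) : R :=
  ln (fine (mgf k t theta)).

Definition Theta_star (k : 'I_N) : set Theta :=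
  argmin setT (fun theta => KL mu (f k) (L k theta)).

Definition N_A : set 'I_N := [set k | Theta_star k theta1].

Definition identifiable : Prop :=
  N_A !=set0 /\ \bigcap_(k in N_A) Theta_star k = [set theta1].

Definition Pi : set 'rV[R]_N :=
  [set pi | [/\ \sum_k pi ord0 k = 1, forall k, 0 < pi ord0 k
    & forall theta, theta != theta1 ->
        0 < \sum_k pi ord0 k * mean_llr k theta]].

Definition Lambda_ave (t : R) (pi : 'rV[R]_N) (theta : Theta) : R :=
  \sum_k Lambda k (pi ord0 k * t) theta.

Definition phi (t : R) (pi : 'rV[R]_N) (theta : Theta) : R :=
  oriented_integral (quotient_ext (fun s => Lambda_ave s pi theta)) 0 t.

(* The infimum is taken in [\bar R], as [phi] could be unbounded below. *)
Definition Phi_theta (pi : 'rV[R]_N) (theta : Theta) : \bar R :=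
  (- ereal_inf (range (fun t => (phi t pi theta)%:E)))%E.

Definition Phi (pi : 'rV[R]_N) : \bar R :=
  \big[mine/+oo%E]_(theta | theta != theta1) Phi_theta pi theta.

(* A maximum as soon as [argmax Pi Phi] is nonempty. *)
Definition Phi_star : \bar R := ereal_sup (Phi @` Pi).

Section noncooperative.
Context {d' : measure_display} {Omega : measurableType d'}.
Variable P : probability Omega R.
(* [xi k m] is the signal of agent [k] at time [m + 1]. *)
Variable xi : 'I_N -> nat -> {RV P >-> T}.

(* [delta * sum_(m >= 0) (1 - delta)^m x_{k,m+1}(theta)]; the series converges
   almost surely for [0 < delta < 1]. *)
Definition nc_statistic (k : 'I_N) (theta : Theta) (delta : R) (w : Omega) : R :=
  delta * limn (series (fun m => (1 - delta) ^+ m * llr k theta (xi k m w))).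

(* [lne 0 = -oo]. *)
Definition Phi_nc (k : 'I_N) (theta : Theta) : \bar R :=
  (- lim ((delta%:E * lne (P [set w | (nc_statistic k theta delta w <= 0)%R]))%E
          @[delta --> 0^'+]))%E.

Definition Phi_nc_sum (theta : Theta) : \bar R := (\sum_k Phi_nc k theta)%E.

End noncooperative.
End model.

(* Main.v *)
Require Import Defs.
From HB Require Import structures.
From mathcomp Require Import all_boot all_order all_algebra.
From mathcomp Require Import all_classical all_reals all_analysis.
From mathcomp Require Import measurable_realfun ring lra.

Set Implicit Arguments.
Unset Strict Implicit.
Unset Printing Implicit Defensive.

Import Order.TTheory GRing.Theory Num.Theory.
Import numFieldNormedType.Exports.

Local Open Scope classical_set_scope.
Local Open Scope ring_scope.

(** With one common model all sets [Theta_star k] coincide, so identifiability says that theta_1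
    alone minimizes the divergence. This is the source of d > 0 for each theta, and it makes the
    uniform vector feasible. The uniform vector attains the bound for all theta at once, hence it
    also attains the minimum over theta; for uniqueness a strict inequality at theta_dagger is
    enough. The main obstacle is that the exponent is defined by probabilities of an infinite
    discounted series. Its moment generating function has to be known exactly before any large
    deviation estimate: the product rule for events is first raised to products of nonnegative
    functions, then carried to the limit by dominated convergence. Lambda enters the analysis on the
    line only through convexity, the bounds d t <= Lambda(t) <= d t + C t^2 (the second for |t| <=
    1) and a positive value at some t < 0. They give the continuity of Lambda(s)/s, with value d at
    0, its monotonicity and its sign change. *)

(* With identical agents every phi(.; pi, theta) is a sum of N rescaled copies
   G(pi_k t) of one primitive G of Lambda(s)/s. Since Lambda is convex with
   Lambda(0) = 0, Lambda'(0) = d > 0 and, L(.|theta_1) and L(.|theta) having the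
   same mass on a common support, Lambda > 0 somewhere on the negative axis,
   Lambda has exactly one negative zero ts, and ts is the only minimizer of G.
   Hence sum_k G(pi_k t) >= N G(ts), and the infimum over t attains this bound
   exactly when all pi_k are equal.

   The non-cooperative exponent is -G(ts): if Y = sum_m q^m x_m and q = 1 - delta,
   then delta ln E[e^(tY)] = delta sum_m Lambda(q^m t) is a geometric Riemann sum
   of G(t), with error O(delta) because Lambda(s)/s is monotone. Chernoff's bound
   at ts is the upper estimate. For the lower one, no tilted measure is needed:
   for s < t < ts and b > 0, e^(ty) - e^(ts y) - e^(-(t-s)b) e^(sy) is at most
   e^(-tb) 1_{y <= 0}, and only its first term survives on the exponential
   scale. *)

(** * Primitives of continuous functions *)

Section primitive.
Context {R : realType}.
Implicit Types (g G : R -> R).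

Lemma continuous_integrable_itv g (a b : R) : continuous g ->
  lebesgue_measure.-integrable `[a, b] (EFin \o g).
Proof.
move=> gc; apply: continuous_compact_integrable; first exact: segment_compact.
exact: continuous_subspaceT.
Qed.

Lemma is_derive_oriented_integral g : continuous g ->
  forall t, is_derive t (1 : R) (oriented_integral g 0) (g t).
Proof.
move=> gc t.
(* The base point [a] lies below both 0 and [t], so that near [t] the two orientations have the
   common form [F x - F 0]. *)
pose a := - `|t| - 1; pose F x := \int[lebesgue_measure]_(s in `[a, x]) g s.
have a0 : a < 0 by rewrite /a; have := normr_ge0 t; lra.
have at_ : a < t by rewrite /a; have := ler_norm (- t); rewrite normrN; lra.
have FE x : a < x -> oriented_integral g 0 x = F x - F 0.
  have shift p q : a < p -> p <= q ->
      \int[lebesgue_measure]_(s in `[p, q]) g s = F q - F p.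
    move=> ap pq; rewrite /F.
    rewrite (@Rintegral_itvB R g (BLeft a) (BRight q) p) ?bnd_simp//; last 2 first.
    - exact: continuous_integrable_itv.
    - exact: ltW.
    rewrite Rintegral_itv_obnd_cbnd//.
    apply: integrableS (continuous_integrable_itv p q gc) => //.
    exact: subset_itv_oc_cc.
  move=> ax; rewrite /oriented_integral; case: (leP 0 x) => [x0|/ltW x0].
    by rewrite shift.
  by rewrite shift// opprB.
have [dF F't] : derivable F t 1 /\ derive1 F t = g t.
  apply: (@continuous_FTC1 _ g (BLeft a) t (t + 1)).
  - by rewrite ltrDl.
  - exact: continuous_integrable_itv.
  - by rewrite lte_fin.
  - exact: gc.
have dG : is_derive t (1 : R) (fun x => F x - F 0) (g t).
  have dF' : is_derive t (1 : R) F (g t).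
    by apply: DeriveDef; [exact: dF|rewrite -derive1E; exact: F't].
  by rewrite -[g t]subr0; apply: is_deriveB.
apply: (near_eq_is_derive _ dG).
near=> x; rewrite FE//.
near: x; exact: lt_nbhsr.
Unshelve. all: by end_near. Qed.

Lemma primitive_continuous g G : (forall t, is_derive t (1 : R) G (g t)) ->
  continuous G.
Proof.
by move=> dG t; apply: differentiable_continuous; apply/derivable1_diffP.
Qed.

Lemma primitive_MVT g G (a b : R) : (forall t, is_derive t (1 : R) G (g t)) ->
  a < b -> exists2 c, a < c < b & G b - G a = g c * (b - a).
Proof.
move=> dG ab; have [c cab E] := MVT ab (fun x _ => dG x)
  (continuous_subspaceT (primitive_continuous dG)).
by exists c => //; move: cab; rewrite in_itv.
Qed.

Lemma oriented_integral_FTC g G : continuous g ->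
  (forall t, is_derive t (1 : R) G (g t)) ->
  forall t, oriented_integral g 0 t = G t - G 0.
Proof.
move=> gc dG t.
have FTC a b : a < b -> \int[lebesgue_measure]_(s in `[a, b]) g s = G b - G a.
  move=> ab; rewrite /Rintegral (@continuous_FTC2 _ g G)//.
  - exact: continuous_subspaceT.
  - have cG := primitive_continuous dG.
    split; first by [].
    + exact/cvg_at_right_filter/cG.
    + exact/cvg_at_left_filter/cG.
  - by move=> x _; rewrite derive1E; apply: derive_val.
rewrite /oriented_integral; have [t0|t0|<-] := ltgtP 0 t.
- by rewrite FTC.
- by rewrite FTC// opprB.
- by rewrite set_itv1 Rintegral_set1 subrr.
Qed.

End primitive.

(** * Cumulant generating functions on the line *)

Lemma ratio_itv01 (R : realFieldType) (x y : R) :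
  0 <= x -> x <= y -> 0 < y -> 0 <= x / y <= 1.
Proof. by move=> x0 xy y0; rewrite divr_ge0 ?(ltW y0)// ler_pdivrMr// mul1r. Qed.

Section cumulant.
Context {R : realType} (Lam : R -> R) (d C : R).
Context (Lam_conv : forall a s t : R, 0 <= a <= 1 ->
           Lam (a * s + (1 - a) * t) <= a * Lam s + (1 - a) * Lam t)
        (Lam_ge : forall t : R, d * t <= Lam t)
        (Lam_le : forall t : R, `|t| <= 1 -> Lam t <= d * t + C * t ^+ 2)
        (d_gt0 : 0 < d) (C_ge0 : 0 <= C)
        (Lam_pos : exists2 t : R, t < 0 & 0 < Lam t).

Local Notation g := (quotient_ext Lam).

Lemma cumulant0 : Lam 0 = 0.
Proof.
apply/eqP; rewrite eq_le; have := Lam_ge 0; have := @Lam_le 0.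
by rewrite normr0 expr0n/= !mulr0 addr0 => /(_ ler01)-> ->.
Qed.

Lemma quotient_extE s : s != 0 -> g s = Lam s / s.
Proof. by rewrite /quotient_ext => /negbTE ->. Qed.

Lemma quotient_ext_bound u : u != 0 -> `|u| <= 1 -> `|Lam u / u - d| <= C * `|u|.
Proof.
move=> u0 u1.
have -> : Lam u / u - d = (Lam u - d * u) / u by rewrite mulrBl mulfK.
rewrite normrM normfV ler_pdivrMr ?normr_gt0// -mulrA -normrM -expr2.
rewrite (ger0_norm (sqr_ge0 u)) ger0_norm ?subr_ge0//.
by rewrite lerBlDl Lam_le.
Qed.

Lemma cvg_quotient_ext0 : Lam u / u @[u --> 0^'] --> d.
Proof.
apply/cvgrPdist_le => e e0.
pose r := Num.min 1 (e / (C + 1)).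
have C1 : 0 < C + 1 by rewrite ltr_wpDl.
have r0 : 0 < r by rewrite lt_min ltr01 divr_gt0.
near=> u.
have u0 : u != 0 by near: u; exact: nbhs_dnbhs_neq.
have ur : `|u| <= r by near: u; exact: dnbhs0_le.
rewrite distrC (le_trans (quotient_ext_bound u0 _))//.
  by rewrite (le_trans ur)// ge_min lexx.
apply: (@le_trans _ _ ((C + 1) * `|u|)).
  by rewrite ler_wpM2r// lerDl.
rewrite mulrC -ler_pdivlMr// (le_trans ur)//.
by rewrite ge_min lexx orbT.
Unshelve. all: by end_near. Qed.

Lemma quotient_ext0 : g 0 = d.
Proof.
rewrite /quotient_ext eqxx; apply/cvg_lim; first exact: Rhausdorff.
exact: cvg_quotient_ext0.
Qed.

Lemma quotient_ext_le s : s <= 0 -> g s <= d.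
Proof.
rewrite le_eqVlt => /predU1P[->|s0]; first by rewrite quotient_ext0.
by rewrite quotient_extE ?lt_eqF// ler_ndivrMr.
Qed.

Lemma quotient_ext_ge s : 0 <= s -> d <= g s.
Proof.
rewrite le_eqVlt => /predU1P[<-|s0]; first by rewrite quotient_ext0.
by rewrite quotient_extE ?gt_eqF// ler_pdivlMr.
Qed.

Lemma cumulant_shrink a t : 0 <= a <= 1 -> Lam (a * t) <= a * Lam t.
Proof.
by move=> a01; have := @Lam_conv a t 0 a01; rewrite cumulant0 !mulr0 !addr0.
Qed.

(** Slopes of chords through the origin of a convex function increase: of two arguments of the same
    sign, the one nearer to 0 is a convex combination of the other and 0. Across the origin the
    value [d] separates the two sides. *)
Lemma quotient_ext_nd : {homo g : s t / s <= t}.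
Proof.
move=> s t st; have [s0|s0] := leP s 0; have [t0|t0] := leP 0 t.
- exact: le_trans (quotient_ext_le s0) (quotient_ext_ge t0).
- have s0' : s < 0 by exact: le_lt_trans t0.
  have ts01 : 0 <= t / s <= 1.
    rewrite ler_ndivrMr// mul1r st andbT.
    by rewrite -mulrNN -invrN divr_ge0// oppr_ge0 ltW.
  rewrite !quotient_extE ?lt_eqF// ler_ndivlMr//.
  have := cumulant_shrink s ts01; rewrite divfK ?lt_eqF//.
  by rewrite (_ : Lam s / s * t = t / s * Lam s)//; ring.
- have t0' : 0 < t by exact: lt_le_trans st.
  have ts01 : 0 <= s / t <= 1.
    exact: ratio_itv01 (ltW s0) st t0'.
  rewrite !quotient_extE ?gt_eqF// ler_pdivrMr//.
  have := cumulant_shrink t ts01; rewrite divfK ?gt_eqF//.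
  by rewrite (_ : Lam t / t * s = s / t * Lam t)//; ring.
- by move: (lt_le_trans s0 st); rewrite ltNge (ltW t0).
Qed.

Lemma cumulant_continuous : continuous Lam.
Proof.
move=> t; apply/cvgrPdist_le => e e0.
pose K := `|Lam (t + 1) - Lam t| + `|Lam t - Lam (t - 1)|.
have K0 : 0 <= K by rewrite addr_ge0.
have K1 : 0 < K + 1 by rewrite ltr_wpDl.
(* Convexity bounds the increment from both sides by chords of length 1: t + s h lies between t and
   t + s, and t = (t + s h) / (1 + h) + (t - s) h / (1 + h) lies between t + s h and t - s. *)
have lip s h : s = 1 \/ s = -1 -> 0 <= h <= 1 -> `|Lam (t + s * h) - Lam t| <= K * h.
  move=> s1 /andP[h0 h1].
  have h1' : 0 < 1 + h by rewrite ltr_pwDl.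
  have up : Lam (t + s * h) - Lam t <= h * (Lam (t + s) - Lam t).
    have := @Lam_conv h (t + s) t; rewrite h0 h1 => /(_ isT).
    rewrite (_ : h * (t + s) + (1 - h) * t = t + s * h); last by ring.
    lra.
  have dn : - (h * (Lam (t - s) - Lam t)) <= Lam (t + s * h) - Lam t.
    have := @Lam_conv (1 + h)^-1 (t + s * h) (t - s).
    rewrite invr_ge0 (ltW h1') invf_le1// lerDl h0 => /(_ isT).
    rewrite (_ : _ + _ * (t - s) = t); last by field; rewrite gt_eqF.
    rewrite -(ler_pM2l h1') mulrDr mulrA divff ?gt_eqF// mul1r.
    rewrite [_ * ((1 - _) * _)]mulrA mulrBr mulr1 divff ?gt_eqF//.
    lra.
  have m1 := ler_norm (Lam (t + 1) - Lam t).
  have m2 := ler_norm (Lam t - Lam (t - 1)).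
  have m3 := ler_norm (- (Lam (t + 1) - Lam t)).
  have m4 := ler_norm (- (Lam t - Lam (t - 1))).
  rewrite !normrN in m3 m4.
  rewrite ler_norml -/K; apply/andP; split.
    apply: le_trans dn; rewrite lerN2 mulrC ler_wpM2r//.
    by rewrite /K; case: s1 => ->; rewrite ?opprK; lra.
  apply: (le_trans up); rewrite mulrC ler_wpM2r//.
  by rewrite /K; case: s1 => ->; lra.
pose r := Num.min 1 (e / (K + 1)).
have r0 : 0 < r by rewrite lt_min ltr01 divr_gt0.
near=> u.
have ur : `|u - t| <= r.
  by rewrite distrC; near: u; exact: cvgr_dist_le.
have u1 : 0 <= `|u - t| <= 1 by rewrite normr_ge0/= (le_trans ur)// ge_min lexx.
have uE : exists2 s, s = 1 \/ s = -1 & u = t + s * `|u - t|.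
  have [ut|ut] := leP 0 (u - t).
  - by exists 1; [left|rewrite (ger0_norm ut); lra].
  - by exists (-1); [right|rewrite (ltr0_norm ut); lra].
case: uE => s s1 ->; rewrite distrC (le_trans (lip _ _ s1 u1))//.
apply: (@le_trans _ _ ((K + 1) * `|u - t|)); first by rewrite ler_wpM2r// lerDl.
rewrite mulrC -ler_pdivlMr// (le_trans ur)//.
by rewrite ge_min lexx orbT.
Unshelve. all: by end_near. Qed.

Lemma quotient_ext_continuous : continuous g.
Proof.
move=> t; have [->|t0] := eqVneq t 0.
  apply/cvgrPdist_le => e e0.
  have /cvgrPdist_le/(_ e e0) := cvg_quotient_ext0.
  rewrite near_withinE; apply: filterS => u ud.
  rewrite quotient_ext0; have [->|u0] := eqVneq u 0.
    by rewrite quotient_ext0 subrr normr0 ltW.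
  by rewrite quotient_extE// ud.
have cq : Lam s / s @[s --> t] --> Lam t / t.
  apply: cvgM; first exact: cumulant_continuous.
  by apply: cvgV => //; exact: cvg_id.
rewrite /continuous_at quotient_extE//.
apply: cvg_trans cq; apply: near_eq_cvg; near=> s.
rewrite quotient_extE//.
by near: s; apply: (@cvgr_neq0 _ _ _ _ _ id t) => //; exact: cvg_id.
Unshelve. all: by end_near. Qed.

(** The quadratic upper bound makes Lambda negative just left of 0, and Lambda is positive somewhere
    further left, so it vanishes in between. Convexity decides the remaining signs by comparison
    with a point [t1] right of the zero where Lambda is negative. *)
Lemma cumulant_zero : exists ts, [/\ ts < 0, Lam ts = 0,
  forall s, s < ts -> 0 < Lam s & forall s, ts < s < 0 -> Lam s < 0].
Proof.
have [t1 t10 Lt1] : exists2 t, t < 0 & Lam t < 0.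
  have D0 : 0 < C + d + 1 by rewrite ltr_wpDl// addr_ge0// ltW.
  (* With x = d / (C + d + 1) one has x < 1 and C x < d, so the quadratic bound applies at - x and
     equals - x (d - C x) < 0. *)
  exists (- (d / (C + d + 1))); first by rewrite oppr_lt0 divr_gt0.
  have x1 : d / (C + d + 1) < 1.
    by rewrite ltr_pdivrMr// mul1r addrAC ltrDr ltr_wpDl.
  have x0 : 0 < d / (C + d + 1) by rewrite divr_gt0.
  have := @Lam_le (- (d / (C + d + 1))).
  rewrite normrN gtr0_norm// (ltW x1) => /(_ isT) /le_lt_trans; apply.
  set x := d / _ in x1 x0 *.
  have -> : d * - x + C * (- x) ^+ 2 = - x * (d - C * x) by ring.
  rewrite mulNr oppr_lt0 mulr_gt0// subr_gt0.
  rewrite [ltRHS](_ : d = x * (C + d + 1)); last by rewrite /x divfK// gt_eqF.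
  by rewrite mulrC ltr_pM2l// -addrA ltrDl addr_gt0.
have shrink_lt0 s : t1 <= s < 0 -> Lam s < 0.
  move=> /andP[ts s0].
  have s01 : 0 <= s / t1 <= 1 by rewrite -mulrNN -invrN ratio_itv01//; lra.
  have := cumulant_shrink t1 s01; rewrite divfK ?lt_eqF//.
  move=> /le_lt_trans; apply.
  by rewrite pmulr_rlt0// -mulrNN -invrN divr_gt0 ?oppr_gt0.
have [t2 t20 Lt2] := Lam_pos.
have t21 : t2 < t1.
  rewrite ltNge; apply/negP => t12.
  by have := shrink_lt0 t2; rewrite t12 t20 ltNge (ltW Lt2) => /(_ isT).
have [ts] : exists2 ts, ts \in `[t2, t1] & Lam ts = 0.
  apply: IVT; first exact: ltW.
    exact/continuous_subspaceT/cumulant_continuous.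
  by rewrite minElt maxElt ltNge (le_trans (ltW Lt1) (ltW Lt2))/= !ltW.
rewrite in_itv/= => /andP[t2s st1] Lts.
have {}st1 : ts < t1.
  by rewrite lt_neqAle st1 andbT; apply: contraTneq Lt1 => <-; rewrite Lts ltxx.
exists ts; split => //; first exact: lt_trans t10.
- move=> s sts; have s1 : 0 < t1 - s by lra.
  (* Here [ts] is between [s] and [t1]; as Lambda is 0 at [ts] and negative at [t1], it must be
     positive at [s]. *)
  have := @Lam_conv ((t1 - ts) / (t1 - s)) s t1.
  rewrite ratio_itv01//; [move=> /(_ isT)|lra|lra].
  rewrite (_ : _ + _ = ts); last by field; rewrite gt_eqF.
  rewrite Lts => H; have : 0 < (t1 - ts) / (t1 - s) * Lam s.
    have : (1 - (t1 - ts) / (t1 - s)) * Lam t1 < 0.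
      by rewrite pmulr_rlt0// subr_gt0 ltr_pdivrMr// mul1r; lra.
    by move: H; lra.
  by rewrite pmulr_rgt0// divr_gt0// subr_gt0.
- move=> s /andP[tss s0]; have [t1s|st] := leP t1 s.
    by apply: shrink_lt0; rewrite t1s s0.
  have s1 : 0 < t1 - ts by lra.
  have := @Lam_conv ((t1 - s) / (t1 - ts)) ts t1.
  rewrite ratio_itv01//; [move=> /(_ isT)|lra|lra].
  rewrite (_ : _ + _ = s); last by field; rewrite gt_eqF.
  rewrite Lts mulr0 add0r => /le_lt_trans; apply.
  by rewrite pmulr_rlt0// subr_gt0 ltr_pdivrMr// mul1r; lra.
Qed.

Lemma quotient_ext_sign : exists ts, [/\ ts < 0, g ts = 0,
  forall s, s < ts -> g s < 0 & forall s, ts < s -> 0 < g s].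
Proof.
have [ts [ts0 Lts Ll Lr]] := cumulant_zero.
exists ts; split => //.
- by rewrite quotient_extE ?lt_eqF// Lts mul0r.
- move=> s sts; have s0 := lt_trans sts ts0.
  by rewrite quotient_extE ?lt_eqF// ltr_ndivrMr// mul0r Ll.
- move=> s tss; have [s0|s0] := leP 0 s.
    exact: lt_le_trans (quotient_ext_ge s0).
  by rewrite quotient_extE ?lt_eqF// ltr_ndivlMr// mul0r Lr// tss.
Qed.

End cumulant.

(** * The rate function *)

Section rate.
Context {R : realType} (g : R -> R) (ts : R).
Context (g_cont : continuous g) (g_nd : {homo g : s t / s <= t})
        (ts_lt0 : ts < 0) (g_ts : g ts = 0)
        (g_neg : forall s, s < ts -> g s < 0)
        (g_pos : forall s, ts < s -> 0 < g s).

Local Notation G := (oriented_integral g 0).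

Lemma oriented_integral0 : G 0 = 0.
Proof. by rewrite /oriented_integral lexx set_itv1 Rintegral_set1. Qed.

Let dG := is_derive_oriented_integral g_cont.

Lemma rate_decr a b : a < b -> b <= ts -> G b < G a.
Proof.
move=> ab bts; have [c /andP[ac cb] E] := primitive_MVT dG ab.
rewrite -subr_lt0 E pmulr_llt0 ?subr_gt0//.
exact/g_neg/(lt_le_trans cb).
Qed.

Lemma rate_incr a b : a < b -> ts <= a -> G a < G b.
Proof.
move=> ab tsa; have [c /andP[ac cb] E] := primitive_MVT dG ab.
rewrite -subr_gt0 E mulr_gt0 ?subr_gt0//.
exact/g_pos/(le_lt_trans tsa).
Qed.

Lemma rate_min s : G ts <= G s.
Proof.
have [sts|tss|->//] := ltgtP s ts; first exact/ltW/rate_decr.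
exact/ltW/rate_incr.
Qed.

(** Strictness for each [t] separately could be lost in the infimum, so a gap uniform in [s] is
    needed. As G decreases up to [ts] and increases after it, the values at [ts - eta] and
    [ts + eta] provide the gap. *)
Lemma rate_min_far eta : 0 < eta -> exists2 e, 0 < e &
  forall s, eta <= `|s - ts| -> G ts + e <= G s.
Proof.
move=> eta0; exists (Num.min (G (ts - eta)) (G (ts + eta)) - G ts).
  rewrite subr_gt0 lt_min; apply/andP; split.
    by apply: rate_decr; rewrite ?lexx//; lra.
  by apply: rate_incr; rewrite ?lexx//; lra.
move=> s far; rewrite addrCA subrr addr0 ge_min.
have [sts|tss] := leP s ts.
  have {far} : s <= ts - eta.
    by move: far; rewrite ler0_norm ?subr_le0//; lra.
  rewrite le_eqVlt => /predU1P[->|lt]; first by rewrite lexx.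
  by rewrite ltW// rate_decr//; lra.
have : ts + eta <= s by move: far; rewrite gtr0_norm ?subr_gt0//; lra.
rewrite le_eqVlt => /predU1P[->|lt]; first by rewrite lexx orbT.
by rewrite orbC (ltW (rate_incr lt _))// lerDl ltW.
Qed.

(** * Infimum of a weighted aggregate of rates *)

Section aggregate.
Context {N : nat} (w : 'I_N -> R).
Context (w_gt0 : forall k, 0 < w k) (w_sum : \sum_k w k = 1).

Lemma aggregate_inf_uniform : (forall k, w k = N%:R^-1) ->
  ereal_inf (range (fun t => (\sum_k G (w k * t))%:E)) = (N%:R * G ts)%:E.
Proof.
move=> wN; have N0 : N%:R != 0 :> R.
  apply: contraPneq w_sum => N0; under eq_bigr do rewrite wN N0 invr0.
  by rewrite big1// => /esym/eqP; rewrite oner_eq0.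
apply/eqP; rewrite eq_le; apply/andP; split.
  apply: ereal_inf_lbound; exists (N%:R * ts) => //; congr EFin.
  under eq_bigr do rewrite wN mulrA mulVf// mul1r.
  by rewrite sumr_const card_ord mulr_natl.
apply: le_ereal_inf_tmp => _ [t _ <-]; rewrite lee_fin.
have -> : N%:R * G ts = \sum_(k < N) G ts by rewrite sumr_const card_ord mulr_natl.
by apply: ler_sum => k _; exact: rate_min.
Qed.

(** When two weights differ, no single [t] brings both [w j * t] and [w k * t] close to [ts]; the
    one that stays away costs a fixed amount, and all other summands are at least G(ts). *)
Lemma aggregate_inf_nonuniform : (exists k, w k != N%:R^-1) ->
  ((N%:R * G ts)%:E <
    ereal_inf (range (fun t => (\sum_k G (w k * t))%:E)))%E.
Proof.
move=> [k wk].
have [j wj] : exists j, w j != w k.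
  apply/existsP; apply: contraT; rewrite negb_exists => /forallP H.
  move: w_sum; under eq_bigr => j _ do rewrite (eqP (negPn (H j))).
  rewrite sumr_const card_ord -mulr_natl => E.
  have N0 : N%:R != 0 :> R.
    by apply: contra_eqN E => /eqP->; rewrite mul0r eq_sym oner_eq0.
  by move: wk; rewrite -[w k](mulKf N0) E mulr1 eqxx.
have wjk : 0 < w j + w k by rewrite addr_gt0.
(* The combination w_k (w_j t - ts) - w_j (w_k t - ts) = (w_j - w_k) ts does not depend on [t]. If
   both deviations were below [eta], its absolute value would be below (w_j + w_k) [eta], which is
   exactly |w_j - w_k| |ts|. *)
pose eta := `|w j - w k| * - ts / (w j + w k).
have eta0 : 0 < eta.
  by rewrite divr_gt0// mulr_gt0 ?oppr_gt0// normr_gt0 subr_eq0.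
have [e e0 far] := rate_min_far eta0.
apply: (@lt_le_trans _ _ (N%:R * G ts + e)%:E); first by rewrite lte_fin ltrDl.
apply: le_ereal_inf_tmp => _ [t _ <-]; rewrite lee_fin.
have [i fi] : exists i, eta <= `|w i * t - ts|.
  have [h1|h1] := leP eta `|w j * t - ts|; first by exists j.
  have [h2|h2] := leP eta `|w k * t - ts|; first by exists k.
  exfalso; have : `|w k * (w j * t - ts) - w j * (w k * t - ts)| <
      w k * eta + w j * eta.
    apply: (le_lt_trans (ler_normB _ _)); rewrite !normrM.
    rewrite (gtr0_norm (w_gt0 k)) (gtr0_norm (w_gt0 j)).
    by apply: ltrD; rewrite ltr_pM2l.
  rewrite (_ : _ - _ = (w j - w k) * ts); last by ring.
  rewrite normrM (ltr0_norm ts_lt0) -mulrDl [w k + _]addrC.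
  by rewrite [_ * eta]mulrC /eta divfK ?gt_eqF// ltxx.
have -> : N%:R * G ts = \sum_(k < N) G ts by rewrite sumr_const card_ord mulr_natl.
rewrite (bigD1 i)//= [leRHS](bigD1 i)//= addrAC lerD ?far//.
by apply: ler_sum => l _; exact: rate_min.
Qed.

End aggregate.

(** * Geometric Riemann sums *)

Section riemann.
Context (t q : R) (t_lt0 : t < 0) (q_itv : 0 < q < 1).

(** On the cell from a = q^m t to q a, of length (1 - q)(- a), the term (1 - q) a g(a) is minus the
    left-endpoint rectangle, while G(a) - G(q a) is minus the integral of g. As g is nondecreasing,
    the error of a cell is at most its length times the increment of g over it. *)
Lemma geometric_riemann_sum n :
  G t - G (q ^+ n * t) <= (1 - q) * \sum_(m < n) q ^+ m * t * g (q ^+ m * t)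
  <= G t - G (q ^+ n * t) + (1 - q) * - t * (g (q ^+ n * t) - g t).
Proof.
have /andP[q0 q1] := q_itv.
elim: n => [|n /andP[IH1 IH2]].
  by rewrite big_ord0 expr0 mul1r !subrr mulr0 mulr0 addr0 lexx.
rewrite big_ord_recr/= mulrDr.
set S := _ * \sum_(m < n) _ in IH1 IH2 *; set a := q ^+ n * t.
have qn0 : 0 < q ^+ n by rewrite exprn_gt0.
have -> : q ^+ n.+1 * t = q * a by rewrite exprS mulrA.
have a0 : a < 0 by rewrite pmulr_rlt0.
have ab : a < q * a.
  rewrite -subr_gt0 (_ : _ - _ = (1 - q) * - a); last by ring.
  by rewrite mulr_gt0 ?subr_gt0 ?oppr_gt0.
have [c /andP[ac cb] E] := primitive_MVT dG ab.
have g1 : g a <= g c by apply: g_nd; exact: ltW.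
have g2 : g c <= g (q * a) by apply: g_nd; exact: ltW.
have D0 : 0 < q * a - a by rewrite subr_gt0.
have M1 : g a * (q * a - a) <= g c * (q * a - a) by rewrite ler_wpM2r// ltW.
have M2 : g c * (q * a - a) <= g (q * a) * (q * a - a) by rewrite ler_wpM2r// ltW.
have aE : (1 - q) * (a * g a) = - (g a * (q * a - a)) by ring.
have at' : t <= a.
  rewrite -subr_ge0 (_ : _ - _ = (1 - q ^+ n) * - t); last by rewrite /a; ring.
  by rewrite mulr_ge0 ?oppr_ge0 ?(ltW t_lt0)// subr_ge0 exprn_ile1// ltW.
(* No cell is longer than the first one, of length (1 - q)(- t); with this common factor the
   increments of g telescope. *)
have M3 : (q * a - a) * (g (q * a) - g a) <= (1 - q) * - t * (g (q * a) - g a).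
  apply: ler_wpM2r; first by rewrite subr_ge0 (le_trans g1).
  rewrite (_ : q * a - a = (1 - q) * - a); last by ring.
  by rewrite ler_wpM2l ?lerN2// subr_ge0 ltW.
rewrite aE; apply/andP; split; first by lra.
move: IH2 M3; rewrite -/a => IH2 M3.
rewrite !mulrBr in IH2 M3 *; rewrite !mulrBr in M1 M2 E; lra.
Qed.

End riemann.

(** The product s g(s) governs the exponential price t b of the lower estimate in [rate_limit]. It
    vanishes at [ts], so a point just left of [ts] makes the price as small as wanted. *)
Lemma small_rate_level e : 0 < e -> exists2 s, s < ts & s * g s <= e.
Proof.
move=> e0.
have : s * g s @[s --> ts] --> ts * g ts.
  by apply: cvgM; [exact: cvg_id|exact: g_cont].
move=> /cvgrPdist_le/(_ e e0); rewrite g_ts mulr0 => /nbhs_ballP[r /= r0 rb].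
exists (ts - r / 2); first by rewrite ltrBlDr ltrDl divr_gt0.
have := rb (ts - r / 2); rewrite /ball/= opprB addrC subrK.
rewrite gtr0_norm ?divr_gt0// => /(_ _).
rewrite sub0r normrN => H; apply: le_trans (ler_norm _) _; apply: H.
by rewrite ltr_pdivrMr// mulr_natr mulr2n ltrDr.
Qed.

Lemma expR_div_small a K : 0 < a ->
  \forall x \near (0 : R)^'+, expR (- (a / x) + K) <= 1 / 4.
Proof.
move=> a0.
have K4 : 0 < `|K| + ln 4 by rewrite ltr_wpDl// ln_gt0// (ltr_nat _ 1 4).
near=> x.
have x0 : 0 < x by near: x; exact: nbhs_right_gt.
have : x <= a / (`|K| + ln 4).
  near: x; exact: nbhs_right_le (divr_gt0 a0 K4).
rewrite ler_pdivlMr// mulrC -ler_pdivlMr// => H.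
have -> : 1 / 4 = expR (- ln 4) :> R by rewrite expRN lnK ?posrE// div1r.
by rewrite ler_expR; have := ler_norm K; lra.
Unshelve. all: by end_near. Qed.

(* [E x] stands for the moment generating function of the discounted sum with
   discount factor [1 - x], and [p x] for the probability that the sum is
   nonpositive; [p_ge] is the pointwise bound of
   [e^{ty} - e^{ts y} - e^{-(t - s)b} e^{sy}] by [e^{-tb} 1_{y <= 0}]
   integrated. *)
Lemma rate_limit (p : R -> R) (E : R -> R -> R) :
  (forall x t, 0 < x < 1 -> t < 0 ->
     expR (G t / x) <= E x t <= expR (G t / x + - t * (g 0 - g t))) ->
  (forall x, 0 < x < 1 -> p x <= E x ts) ->
  (forall x s t b, 0 < x < 1 -> s < t -> t < ts -> 0 < b ->
     expR (t * b) * (E x t - E x ts - expR (- ((t - s) * b)) * E x s) <= p x) ->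
  (x%:E * lne (p x)%:E)%E @[x --> 0^'+] --> (G ts)%:E.
Proof.
move=> EG p_le p_ge.
have key e : 0 < e -> \forall x \near 0^'+,
    0 < p x /\ G ts - e <= x * ln (p x) <= G ts + e.
  move=> e0; have e4 : 0 < e / 4 by rewrite divr_gt0.
  have [s sts gs] := small_rate_level e4.
  (* By the mean value theorem G(s) - G(t) <= - g(s) (t - s), so the factor 2 makes (t - s) b
     strictly larger than G(s) - G(t) and the cut-off term decays faster than the main one. The
     price stays small, since t b = - 2 t g(s) >= - 2 s g(s) >= - e / 2. *)
  pose t := (s + ts) / 2; pose b := - 2 * g s.
  have st : s < t by rewrite /t; lra.
  have tts : t < ts by rewrite /t; lra.
  have t0 : t < 0 by exact: lt_trans ts_lt0.
  have s0 : s < 0 by exact: lt_trans t0.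
  have gs0 : g s < 0 := g_neg sts.
  have b0 : 0 < b by rewrite /b; lra.
  have tb : - (e / 2) <= t * b.
    have : t * g s <= s * g s by rewrite ler_nM2r// ltW.
    by rewrite /b; lra.
  have Gt : G ts < G t by apply: rate_decr.
  have Gs : G s - (t - s) * b < G t.
    have [c /andP[sc ct] Ec] := primitive_MVT dG st.
    have gsc : g s * (t - s) <= g c * (t - s).
      by apply: ler_wpM2r; [rewrite subr_ge0 ltW|exact/g_nd/ltW].
    have : g s * (t - s) < 0 by rewrite pmulr_llt0 ?subr_gt0.
    by move: Ec gsc; rewrite /b; lra.
  pose K1 := - ts * (g 0 - g ts); pose K2 := - s * (g 0 - g s).
  have h1 : 0 < G t - G ts by rewrite subr_gt0.
  have h2 : 0 < G t - (G s - (t - s) * b) by rewrite subr_gt0.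
  have l2 : 0 < ln 2 :> R by rewrite ln_gt0// (ltr_nat _ 1 2).
  have e2 : 0 < e / 2 / ln 2 by rewrite !divr_gt0.
  have eK : 0 < e / (`|K1| + 1) by rewrite divr_gt0// ltr_wpDl.
  near=> x.
  have x0 : 0 < x by near: x; exact: nbhs_right_gt.
  have x1 : 0 < x < 1 by rewrite x0/=; near: x; exact: nbhs_right_lt.
  (* Each of the two subtracted terms is to be at most a quarter of exp(G(t) / x), so that half of
     it remains; the lost factor 2 costs x ln 2 on the scale of the limit. *)
  have S1 : expR (- ((G t - G ts) / x) + K1) <= 1 / 4.
    by near: x; exact: expR_div_small.
  have S2 : expR (- ((G t - (G s - (t - s) * b)) / x) + K2) <= 1 / 4.
    by near: x; exact: expR_div_small.
  have xK1 : x * K1 <= e.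
    have : x <= e / (`|K1| + 1) by near: x; exact: nbhs_right_le.
    rewrite ler_pdivlMr// => /(le_trans _); apply; rewrite ler_pM2l//.
    by rewrite (le_trans (ler_norm _))// lerDl.
  have xln2 : x * ln 2 <= e / 2.
    by rewrite -ler_pdivlMr//; near: x; exact: nbhs_right_le.
  have lower : expR ((t * b + G t) / x) / 2 <= p x.
    (* The statistic is [x] times the discounted sum, so a cut-off at level - b for the statistic is
       one at - b / x for the sum. *)
    have bx0 : 0 < b / x by rewrite divr_gt0.
    apply: le_trans (p_ge x s t (b / x) x1 st tts bx0).
    rewrite mulrDl expRD -mulrA [t * (b / x)]mulrA ler_pM2l ?expR_gt0//.
    have /andP[Et _] := EG x t x1 t0.
    have /andP[_ Ets] := EG x ts x1 ts_lt0.
    have /andP[_ Es] := EG x s x1 s0.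
    set T := expR (G t / x) in Et *.
    have T0 : 0 < T by exact: expR_gt0.
    have U1 : E x ts <= T * (1 / 4).
      apply: (le_trans Ets); apply: le_trans (ler_wpM2l (ltW T0) S1).
      by rewrite -expRD ler_expR le_eqVlt; apply/orP; left; apply/eqP; rewrite /K1; ring.
    have U2 : expR (- ((t - s) * (b / x))) * E x s <= T * (1 / 4).
      apply: (le_trans (ler_wpM2l (expR_ge0 _) Es)).
      apply: le_trans (ler_wpM2l (ltW T0) S2).
      by rewrite -!expRD ler_expR le_eqVlt; apply/orP; left; apply/eqP; rewrite /K2; ring.
    lra.
  have px0 : 0 < p x by apply: lt_le_trans lower; rewrite divr_gt0 ?expR_gt0.
  split => //; apply/andP; split.
    have : ln (expR ((t * b + G t) / x) / 2) <= ln (p x).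
      by rewrite ler_ln ?posrE// divr_gt0 ?expR_gt0.
    rewrite ln_div ?posrE ?expR_gt0// expRK => /(ler_wpM2l (ltW x0)).
    rewrite mulrBr [x * (_ / x)]mulrC divfK ?gt_eqF//.
    by move: xln2 tb Gt; lra.
  have /andP[_ Ets] := EG x ts x1 ts_lt0.
  have : ln (p x) <= G ts / x + K1.
    rewrite -[leRHS]expRK ler_ln ?posrE ?expR_gt0//.
    exact: le_trans (p_le x x1) Ets.
  move=> /(ler_wpM2l (ltW x0)); rewrite mulrDr [x * (_ / x)]mulrC divfK ?gt_eqF//.
  by move: xK1; lra.
have lim : x * ln (p x) @[x --> 0^'+] --> G ts.
  apply/cvgrPdist_le => e e0; near=> x.
  have [_ /andP[l u]] : 0 < p x /\ G ts - e <= x * ln (p x) <= G ts + e.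
    by near: x; exact: key.
  by rewrite ler_norml; apply/andP; split; lra.
apply: cvg_trans (cvg_comp _ _ lim (cvg_id : EFin @ G ts --> (G ts)%:E)).
apply: near_eq_cvg; near=> x => /=.
(* Positivity of [p x] turns [lne] into the real logarithm. *)
have [px0 _] : 0 < p x /\ G ts - 1 <= x * ln (p x) <= G ts + 1.
  by near: x; exact: key.
by rewrite leNgt px0.
Unshelve. all: by end_near. Qed.

End rate.

(** * Independence and expectations of products *)

Section weighted_integral.
Local Open Scope ereal_scope.
Context {R : realType} {d1 d : measure_display}.
Context {Omega : measurableType d1} {T : measurableType d}.
Context (m : {measure set Omega -> \bar R}).
Context (Y : Omega -> T) (W : Omega -> R).
Context (mY : measurable_fun setT Y) (mW : measurable_fun setT W)
        (W0 : forall w, (0 <= W w)%R).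

Import HBNNSimple.

Lemma weighted_integral_nnsfun (f : {nnsfun T >-> R}) :
  \int[m]_w ((f (Y w))%:E * (W w)%:E) =
  \sum_(r \in range f)
    r%:E * \int[m]_w ((\1_(f @^-1` [set r]) (Y w))%:E * (W w)%:E).
Proof.
transitivity (\int[m]_w (\sum_(r \in range f)
    (r * \1_(f @^-1` [set r]) (Y w))%:E * (W w)%:E)).
  apply: eq_integral => w _; rewrite fimfunE -fsumEFin//.
  rewrite ge0_mule_fsuml// => r; rewrite EFinM; exact: nnfun_muleindic_ge0.
have mWE : measurable_fun setT (EFin \o W) by exact/measurable_EFinP.
have mind r : measurable_fun setT (fun w => (\1_(f @^-1` [set r]) (Y w))%:E : \bar R).
  apply/measurable_EFinP; apply: measurableT_comp => //.
rewrite ge0_integral_fsum//; last 2 first.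
- move=> r; apply: emeasurable_funM => //.
  under eq_fun do rewrite EFinM; exact: emeasurable_funM.
- move=> r w _; apply: mule_ge0; last by rewrite lee_fin.
  by rewrite EFinM; exact: nnfun_muleindic_ge0.
apply: eq_fsbigr => r; rewrite inE => -[x _ <-].
under eq_integral do rewrite EFinM -muleA.
rewrite ge0_integralZl ?lee_fin//; first exact: emeasurable_funM.
by move=> w _; rewrite mule_ge0// ?lee_fin//.
Qed.

Lemma weighted_integral_limn (h : T -> \bar R)
    (mh : measurable_fun setT h) : (forall x, 0 <= h x) ->
  \int[m]_w (h (Y w) * (W w)%:E) =
  limn (fun n => \int[m]_w ((nnsfun_approx measurableT mh n (Y w))%:E * (W w)%:E)).
Proof.
have mWE : measurable_fun setT (EFin \o W) by exact/measurable_EFinP.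
move=> h0; rewrite -monotone_convergence//.
- apply: eq_integral => w _; apply/esym/cvg_lim => //.
  by apply: cvgeZr => //; apply: cvg_nnsfun_approx.
- move=> n; apply: emeasurable_funM => //.
  by apply/measurable_EFinP; apply: measurableT_comp.
- by move=> n w _; rewrite mule_ge0// ?lee_fin//.
- move=> w _ a b ab; apply: lee_wpmul2r; rewrite lee_fin//.
  exact/lefP/nd_nnsfun_approx.
Qed.

End weighted_integral.

Section eq_weighted_integral.
Import HBNNSimple.

(** Two weighted laws that agree on events integrate every nonnegative function alike, by simple
    functions and monotone convergence. It serves twice: with the remaining independent factors as
    weight against a constant weight, and with the weight 1 under [P] against a density under
    [mu]. *)
Lemma ge0_eq_weighted_integral (R : realType) (d1 d2 d : measure_display)
    (O1 : measurableType d1) (O2 : measurableType d2) (T : measurableType d)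
    (m1 : {measure set O1 -> \bar R}) (m2 : {measure set O2 -> \bar R})
    (Y1 : O1 -> T) (Y2 : O2 -> T) (W1 : O1 -> R) (W2 : O2 -> R)
    (h : T -> \bar R) :
  measurable_fun setT Y1 -> measurable_fun setT Y2 ->
  measurable_fun setT W1 -> measurable_fun setT W2 ->
  (forall w, 0 <= W1 w) -> (forall w, 0 <= W2 w) ->
  (forall B, measurable B -> \int[m1]_w ((\1_B (Y1 w))%:E * (W1 w)%:E) =
                             \int[m2]_w ((\1_B (Y2 w))%:E * (W2 w)%:E))%E ->
  measurable_fun setT h -> (forall x, 0 <= h x)%E ->
  (\int[m1]_w (h (Y1 w) * (W1 w)%:E) = \int[m2]_w (h (Y2 w) * (W2 w)%:E))%E.
Proof.
move=> mY1 mY2 mW1 mW2 W10 W20 eqW mh h0.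
rewrite (weighted_integral_limn m1 mY1 mW1 W10 mh h0).
rewrite (weighted_integral_limn m2 mY2 mW2 W20 mh h0); congr (limn _); apply/funext => n.
rewrite !weighted_integral_nnsfun//; apply: eq_fsbigr => r _.
by rewrite eqW//; exact: measurable_funPTI.
Qed.

End eq_weighted_integral.

Section independence.
Context {R : realType} {d d' : measure_display}.
Context {Omega : measurableType d} {T : measurableType d'} {I : choiceType}.
Context (P : probability Omega R) (Y : I -> Omega -> T).
Context (mY : forall i, measurable_fun setT (Y i)) (Y_indep : mutually_independent P Y).

Lemma prod_indic (r : seq I) (B : I -> set T) w :
  \prod_(i <- r) \1_(B i) (Y i w) =
  \1_(\bigcap_(i in [set` r]) (Y i @^-1` B i)) w :> R.
Proof.
rewrite bigcap_seq; elim: r => [|i r IH]; first by rewrite !big_nil indicT.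
by rewrite !big_cons IH indicI.
Qed.

Context (h : I -> T -> R) (mh : forall i, measurable_fun setT (h i))
        (h0 : forall i x, 0 <= h i x)
        (h_fin : forall i, (\int[P]_w (h i (Y i w))%:E \is a fin_num)%E).

Lemma measurable_prod_comp (s : seq I) (u : I -> T -> R) :
  (forall i, measurable_fun setT (u i)) ->
  measurable_fun setT (fun w => \prod_(i <- s) u i (Y i w)).
Proof.
by move=> mu; apply: measurable_prod => i _; apply: measurableT_comp.
Qed.

(** Keeping functions and events side by side lets the induction run on the functions alone. To
    treat [h i], the remaining factors become a weight, and an indicator in place of [h i] is the
    induction hypothesis with [i] moved to the events. *)
Lemma independent_mixed_product (s r : seq I) (B : I -> set T) :
  uniq (s ++ r) -> (forall i, measurable (B i)) ->
  (\int[P]_w ((\prod_(i <- s) h i (Y i w)) * \prod_(i <- r) \1_(B i) (Y i w))%:E =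
   (\prod_(i <- s) \int[P]_w (h i (Y i w))%:E)
   * \prod_(i <- r) P (Y i @^-1` B i))%E.
Proof.
have mYB i A : measurable A -> measurable (Y i @^-1` A).
  by move=> mA; rewrite -[X in measurable X]setTI; exact: mY.
have PB_fin (r' : seq I) A : (forall i, measurable (A i)) ->
    (\prod_(i <- r') P (Y i @^-1` A i))%E \is a fin_num.
  by move=> mA; apply: prode_fin_num => i _; apply: fin_num_measure; exact: mYB.
elim: s r B => [|i s IH] r B u mB.
  rewrite big_nil mul1e -Y_indep//.
  under eq_integral do rewrite big_nil mul1r prod_indic.
  rewrite integral_indic ?setIT//.
  by apply: fin_bigcap_measurable => // j _; exact: mYB.
have {u} [/norP[iNs iNr] u] : ~~ ((i \in s) || (i \in r)) /\ uniq (s ++ r).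
  by move: u; rewrite /= mem_cat => /andP[].
pose W w := (\prod_(j <- s) h j (Y j w)) * \prod_(j <- r) \1_(B j) (Y j w).
pose C := ((\prod_(j <- s) \int[P]_w (h j (Y j w))%:E)
   * \prod_(j <- r) P (Y j @^-1` B j))%E.
have C_fin : C \is a fin_num.
  rewrite fin_numM//; last exact: PB_fin.
  by apply: prode_fin_num => j _.
have C0 : (0 <= C)%E.
  apply: mule_ge0; apply: prode_ge0 => j _ //.
  by apply: integral_ge0 => w _; rewrite lee_fin.
have mW : measurable_fun setT W.
  apply: measurable_funM; first exact: measurable_prod_comp.
  by apply: (@measurable_prod_comp r (fun j => \1_(B j))) => j;
    exact: measurable_indic.
have W0 w : 0 <= W w by rewrite mulr_ge0// prodr_ge0.
transitivity (\int[P]_w (((h i (Y i w))%:E) * (W w)%:E))%E.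
  by apply: eq_integral => w _; rewrite big_cons -EFinM -mulrA.
rewrite (@ge0_eq_weighted_integral _ _ _ _ _ _ _ P P (Y i) (Y i) W
  (cst (fine C)) (EFin \o h i))//; last 4 first.
- by move=> w; apply: fine_ge0.
- move=> A mA; pose B' j := if j == i then A else B j.
  have B'i : B' i = A by rewrite /B' eqxx.
  have B'r j : j \in r -> B' j = B j.
    by rewrite /B'; case: eqP => // -> ir; rewrite ir in iNr.
  transitivity (\int[P]_w ((\prod_(j <- s) h j (Y j w)) *
      \prod_(j <- i :: r) \1_(B' j) (Y j w))%:E)%E.
    apply: eq_integral => w _; rewrite -EFinM big_cons B'i mulrCA.
    congr (_ * (_ * _))%:E; apply: eq_big_seq => j jr.
    by rewrite B'r.
  rewrite IH; last 2 first.
  + by rewrite uniq_catC /= mem_cat negb_or iNr iNs uniq_catC.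
  + by move=> j; rewrite /B'; case: ifP.
  rewrite big_cons B'i.
  have -> : (\prod_(j <- r) P (Y j @^-1` B' j) =
             \prod_(j <- r) P (Y j @^-1` B j))%E.
    by apply: eq_big_seq => j jr; rewrite B'r.
  under [RHS]eq_integral do rewrite /= fineK//.
  rewrite ge0_integralZr//; last first.
    by apply/measurable_EFinP/measurableT_comp.
  by rewrite (integral_indic _ _ (mYB i A mA)) ?setIT// muleCA muleC.
- exact/measurable_EFinP.
- by move=> x; rewrite lee_fin.
under eq_integral do rewrite /= fineK//.
rewrite ge0_integralZr//; last 2 first.
- by apply/measurable_EFinP/measurableT_comp.
- by move=> w _; rewrite lee_fin.
by rewrite big_cons muleA.
Qed.

Lemma independent_integral_prod (s : seq I) : uniq s ->
  (\int[P]_w (\prod_(i <- s) h i (Y i w))%:E =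
   \prod_(i <- s) \int[P]_w (h i (Y i w))%:E)%E.
Proof.
move=> us; have := @independent_mixed_product s [::] (fun=> setT).
rewrite cats0 !big_nil mule1 => <-//.
by apply: eq_integral => w _; rewrite big_nil mulr1.
Qed.

End independence.

(** * Discounted sums *)

(** Averaging the tangent inequality at the barycenter [w] removes its linear term. *)
Lemma expR_convex (R : realType) (a u v : R) : 0 <= a <= 1 ->
  expR (a * u + (1 - a) * v) <= a * expR u + (1 - a) * expR v.
Proof.
move=> /andP[a0 a1]; set w := _ + _.
have tangent z : expR w * (1 + (z - w)) <= expR z.
  have -> : expR z = expR w * expR (z - w) by rewrite -expRD addrC subrK.
  by rewrite ler_pM2l ?expR_gt0// expR_ge1Dx.
have b0 : 0 <= 1 - a by rewrite subr_ge0.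
have := lerD (ler_wpM2l a0 (tangent u)) (ler_wpM2l b0 (tangent v)).
apply: le_trans; rewrite le_eqVlt; apply/orP; left; apply/eqP.
by rewrite /w; ring.
Qed.

Lemma limn_einf_esup_cvg (R : realType) (u : (\bar R)^nat) l :
  limn_einf u = l -> limn_esup u = l -> u @ \oo --> l.
Proof.
move=> il sl; apply: (@squeeze_cvge _ _ _ _ (einfs u) _ (esups u)).
- apply: nearW => n; apply/andP; split.
    by apply: ereal_inf_lbound; exists n => /=.
  by apply: ereal_sup_ubound; exists n => /=.
- by rewrite -il limn_einf_lim; exact: is_cvg_einfs.
- by rewrite -sl limn_esup_lim; exact: is_cvg_esups.
Qed.

(* Where the sequence diverges, [limn] is the default point of [R]. *)
Lemma measurable_fun_limn (R : realType) (d : measure_display)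
    (T : measurableType d) (u : (T -> R)^nat) :
  (forall n, measurable_fun setT (u n)) ->
  measurable_fun setT (fun w => limn (u ^~ w)).
Proof.
move=> mu.
pose s w := limn_esup (fun n => (u n w)%:E).
pose i w := limn_einf (fun n => (u n w)%:E).
have ms : measurable_fun setT s.
  by apply: measurable_fun_limn_esup => n; exact/measurable_EFinP.
have mi : measurable_fun setT i.
  apply: measurableT_comp => //.
  apply: measurable_fun_limn_esup => n.
  by apply: measurableT_comp => //; exact/measurable_EFinP.
(* This is convergence to a real number, expressed by measurable data: liminf and limsup agree and
   are finite. *)
pose c w := (i w == s w) && (s w == (fine (s w))%:E).
have mc : measurable_fun setT c.
  apply: measurable_and; apply: measurable_fun_eqe => //.
  by apply/measurable_EFinP; exact: measurableT_comp.
rewrite (_ : (fun w => _) = (fun w => if c w then fine (s w) else point)).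
  by apply: measurable_fun_ifT => //; exact: measurableT_comp.
apply/funext => w; rewrite /c; case: ifPn => [/andP[/eqP is_ /eqP sE]|ncv].
  apply/cvg_lim => //.
  have : (fun n => (u n w)%:E) @ \oo --> (fine (s w))%:E.
    by apply: limn_einf_esup_cvg; rewrite -sE// -is_.
  by move/fine_cvgP => [].
apply: dvgP; apply: contraNnot ncv => /cvg_ex[l ul].
have uE : (fun n => (u n w)%:E) @ \oo --> l%:E.
  by apply: cvg_EFin => //; exact: nearW.
by rewrite /i /s; have [-> ->] := cvg_limn_einf_sup uE; rewrite /= !eqxx.
Qed.

Section discounted_sum.
Context {R : realType} {d : measure_display} {Omega : measurableType d}.
Context (P : probability Omega R) (x : nat -> Omega -> R) (M : R -> R).
Context (mx : forall m, measurable_fun setT (x m))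
        (x_indep : mutually_independent P x)
        (x_mgf : forall m t, (\int[P]_w (expR (t * x m w))%:E = (M t)%:E)%E).

Local Notation partial q w := (series (fun m => q ^+ m * x m w)).
Local Notation abs_partial q w := (series (fun m => `|q ^+ m * x m w|)).

Lemma measurable_partial q n : measurable_fun setT (fun w => partial q w n).
Proof.
by apply: measurable_sum => m; apply: measurable_funM.
Qed.

Lemma measurable_abs_partial q n :
  measurable_fun setT (fun w => abs_partial q w n).
Proof.
apply: measurable_sum => m; apply: measurableT_comp => //.
exact: measurable_funM.
Qed.

Lemma partial_mgf q t n :
  (\int[P]_w (expR (t * partial q w n))%:E =
   (\prod_(m <- index_iota 0 n) M (q ^+ m * t))%:E)%E.
Proof.
pose h m y := expR (q ^+ m * t * y).
have Eh m : (\int[P]_w (h m (x m w))%:E = (M (q ^+ m * t))%:E)%E.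
  by rewrite -(x_mgf m).
transitivity (\int[P]_w (\prod_(m <- index_iota 0 n) h m (x m w))%:E)%E.
  apply: eq_integral => w _; rewrite -expR_sum mulr_sumr; congr (expR _)%:E.
  by apply: eq_bigr => m _; rewrite mulrA [t * _]mulrC.
rewrite (independent_integral_prod mx x_indep (h := h)).
- by rewrite -prodEFin; apply: eq_bigr => m _; exact: Eh.
- by move=> m; apply: measurableT_comp => //; exact: measurable_funM.
- by move=> m y; exact: expR_ge0.
- by move=> m; rewrite Eh.
- exact: iota_uniq.
Qed.

(** Convexity between the exponents 0 and s |x| gives a bound 1 + a (...), and then exp(a (...)).
    With a = q^m the factors multiply to the exponential of a convergent geometric series, which
    keeps the product bounded in the number of terms. *)
Lemma abs_mgf_le s a m : 0 <= s -> 0 <= a <= 1 ->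
  (\int[P]_w (expR (a * s * `|x m w|))%:E <= (expR (a * (M s + M (- s))))%:E)%E.
Proof.
move=> s0 a01; have /andP[a0 a1] := a01.
have mE t : measurable_fun setT (fun w => (expR (t * x m w))%:E).
  apply/measurable_EFinP; apply: measurableT_comp => //.
  exact: measurable_funM.
have E0 t w : (0 <= (expR (t * x m w))%:E)%E by rewrite lee_fin expR_ge0.
apply: (@le_trans _ _ (\int[P]_w
    (cst 1%E w + a%:E * ((expR (s * x m w))%:E + (expR (- s * x m w))%:E)))%E).
  apply: ge0_le_integral => //.
  - apply/measurable_EFinP; apply: measurableT_comp => //.
    by apply: measurable_funM => //; exact: measurableT_comp.
  - apply: emeasurable_funD => //; apply: emeasurable_funM => //.
    exact: emeasurable_funD.
  move=> w _.
  have H : expR (s * `|x m w|) <= expR (s * x m w) + expR (- s * x m w).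
    have [x0|x0] := leP 0 (x m w); first by rewrite ger0_norm// lerDl expR_ge0.
    by rewrite ltr0_norm// mulrN mulNr lerDr expR_ge0.
  have : expR (a * s * `|x m w|) <=
      1 + a * (expR (s * x m w) + expR (- s * x m w)).
    have := expR_convex (s * `|x m w|) 0 a01.
    rewrite mulr0 addr0 expR0 mulr1 mulrA => /le_trans; apply.
    by have := ler_wpM2l a0 H; move: a0; lra.
  by rewrite -lee_fin.
rewrite ge0_integralD//; last 2 first.
- by move=> w _; apply: mule_ge0 => //; exact: adde_ge0.
- apply: emeasurable_funM => //; exact: emeasurable_funD.
have -> : (\int[P]_w cst 1 w = 1)%E.
  by rewrite integral_cst// mul1e; exact: probability_setT.
rewrite ge0_integralZl//; last 2 first.
- exact: emeasurable_funD.
- by move=> w _; exact: adde_ge0.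
rewrite ge0_integralD// !x_mgf -[leLHS]/((1 + a * (M s + M (- s)))%:E) lee_fin.
exact: expR_ge1Dx.
Qed.

Lemma abs_partial_mgf_le q s n : 0 < q < 1 -> 0 <= s ->
  (\int[P]_w (expR (s * abs_partial q w n))%:E <=
   (expR ((M s + M (- s)) / (1 - q)))%:E)%E.
Proof.
move=> /andP[q0 q1] s0; pose h m (y : R) := expR (q ^+ m * s * `|y|).
have qm01 m : 0 <= q ^+ m <= 1.
  by rewrite exprn_ge0 ?exprn_ile1// ltW.
have M0 t : 0 <= M t.
  rewrite -lee_fin -(x_mgf 0); apply: integral_ge0 => w _.
  by rewrite lee_fin expR_ge0.
have Eh0 m : (0 <= \int[P]_w (h m (x m w))%:E)%E.
  by apply: integral_ge0 => w _; rewrite lee_fin expR_ge0.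
have -> : (\int[P]_w (expR (s * abs_partial q w n))%:E =
    \int[P]_w (\prod_(m <- index_iota 0 n) h m (x m w))%:E)%E.
  apply: eq_integral => w _; rewrite -expR_sum mulr_sumr; congr (expR _)%:E.
  apply: eq_bigr => m _; rewrite normrM ger0_norm ?exprn_ge0 ?(ltW q0)//.
  by rewrite mulrA [s * _]mulrC.
rewrite (independent_integral_prod mx x_indep (h := h)).
- apply: (@le_trans _ _ (\prod_(m <- index_iota 0 n)
      (expR (q ^+ m * (M s + M (- s))))%:E)%E).
    elim: (index_iota 0 n) => [|m r IH]; first by rewrite !big_nil.
    rewrite !big_cons; apply: lee_pmul => //.
    + by apply: prode_ge0 => j _.
    + exact: abs_mgf_le.
  rewrite prodEFin lee_fin -expR_sum ler_expR -mulr_suml mulrC.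
  apply: ler_wpM2l; first exact: addr_ge0.
  have q1' : 0 < 1 - q by rewrite subr_gt0.
  rewrite -(ler_pM2l q1') divff ?gt_eqF// big_mkord.
  rewrite -opprB mulNr -subrX1 opprB lerBlDr lerDl exprn_ge0//.
  exact: ltW.
- by move=> m; apply: measurableT_comp => //; apply: measurable_funM => //;
    exact: measurableT_comp.
- by move=> m y; exact: expR_ge0.
- move=> m; rewrite ge0_fin_numE//.
  exact: le_lt_trans (abs_mgf_le m s0 (qm01 m)) (ltry _).
- exact: iota_uniq.
Qed.

(** The dominating function is the increasing limit of the exponentials of the absolute partial
    sums, integrable since their integrals are uniformly bounded. Its finiteness almost everywhere
    yields the convergence of the series, and its integrability the passage to the limit in the
    moment generating function. *)
Lemma discounted_dominated q s : 0 < q < 1 -> 0 <= s ->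
  exists2 D : Omega -> \bar R, P.-integrable setT D &
    (forall w n, ((expR (s * abs_partial q w n))%:E <= D w)%E).
Proof.
move=> q01 s0.
pose e n w := (expR (s * abs_partial q w n))%:E.
have me n : measurable_fun setT (e n).
  apply/measurable_EFinP; apply: measurableT_comp => //.
  by apply: measurable_funM => //; exact: measurable_abs_partial.
have e0 n w : (0 <= e n w)%E by rewrite lee_fin expR_ge0.
have nd w : nondecreasing_seq (e ^~ w).
  move=> m n mn; rewrite lee_fin ler_expR ler_wpM2l//.
  exact: nondecreasing_series.
have cve w : cvgn (e ^~ w) by exact: ereal_nondecreasing_is_cvgn.
have eD w n : (e n w <= limn (e ^~ w))%E.
  by apply: lime_ge => //; exists n => // m /= nm; exact: nd.
exists (fun w => limn (e ^~ w)) => //; apply/integrableP; split.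
  by apply: (emeasurable_fun_cvg e) => // w _; exact: cve.
apply: (@le_lt_trans _ _ (expR ((M s + M (- s)) / (1 - q)))%:E); last exact: ltry.
rewrite (eq_integral (fun w => limn (e ^~ w))); last first.
  by move=> w _; rewrite gee0_abs// (le_trans (e0 0%N w)).
rewrite monotone_convergence//.
apply: lime_le.
  apply: ereal_nondecreasing_is_cvgn => m n mn.
  by apply: ge0_le_integral => // w _; exact: nd.
by apply: nearW => n; exact: abs_partial_mgf_le.
Qed.

Lemma discounted_cvg q : 0 < q < 1 ->
  {ae P, forall w, cvgn (partial q w)}.
Proof.
move=> q01; have [D iD De] := discounted_dominated q01 ler01.
have := integrable_ae measurableT iD; apply: filterS => w /(_ I) Dfin.
apply: normed_cvg; apply: nondecreasing_is_cvgn.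
  by apply: (@nondecreasing_series _ (fun m => `|q ^+ m * x m w|) xpredT 0%N).
exists (fine (D w)) => _ [n _ <-].
have := De w n; rewrite mul1r -(fineK Dfin) lee_fin; apply: le_trans.
by rewrite (le_trans _ (expR_ge1Dx _))// lerDr.
Qed.

Lemma discounted_mgf q t : 0 < q < 1 ->
  P.-integrable setT (fun w => (expR (t * limn (partial q w)))%:E) /\
  (\prod_(m <- index_iota 0 n) M (q ^+ m * t))%:E @[n --> \oo] -->
    (\int[P]_w (expR (t * limn (partial q w)))%:E)%E.
Proof.
move=> q01; have [D iD De] := discounted_dominated q01 (normr_ge0 t).
have ml : measurable_fun setT (fun w => limn (partial q w)).
  by apply: measurable_fun_limn => n; exact: measurable_partial.
have mexp (u : Omega -> R) : measurable_fun setT u ->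
    measurable_fun setT (fun w => (expR (t * u w))%:E).
  move=> mu; apply/measurable_EFinP; apply: measurableT_comp => //.
  exact: measurable_funM.
have [] := @dominated_convergence _ Omega R P setT measurableT
  (fun n w => (expR (t * partial q w n))%:E)
  (fun w => (expR (t * limn (partial q w)))%:E) D.
- by move=> n; apply: mexp; exact: measurable_partial.
- exact: mexp.
- have := discounted_cvg q01; apply: filterS => w cw _.
  apply: cvg_EFin; first exact: nearW.
  apply: (@continuous_cvg _ _ _ _ _ _ expR); first exact: continuous_expR.
  by apply: cvgM => //; exact: cvg_cst.
- exact: iD.
- apply: aeW => w n _; apply: le_trans (De w n).
  rewrite gee0_abs ?lee_fin ?expR_ge0// ler_expR.
  rewrite (le_trans (ler_norm _))// normrM ler_wpM2l//.
  exact: ler_norm_sum.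
move=> int _ cv; split => //.
by under eq_cvg do rewrite -partial_mgf.
Qed.

End discounted_sum.

(** * The exponent of a discounted sum *)

Section discounted_rate.
Context {R : realType} {d : measure_display} {Omega : measurableType d}.
Context (P : probability Omega R) (x : nat -> Omega -> R) (g : R -> R) (ts : R).
Context (mx : forall m, measurable_fun setT (x m))
        (x_indep : mutually_independent P x)
        (x_mgf : forall m t,
           (\int[P]_w (expR (t * x m w))%:E = (expR (t * g t))%:E)%E).
Context (g_cont : continuous g) (g_nd : {homo g : s t / s <= t})
        (ts_lt0 : ts < 0) (g_ts : g ts = 0)
        (g_neg : forall s, s < ts -> g s < 0).

Local Notation G := (oriented_integral g 0).
Local Notation dsum q w := (limn (series (fun m => q ^+ m * x m w))).

Lemma measurable_dsum q : measurable_fun setT (fun w => dsum q w).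
Proof. by apply: measurable_fun_limn => n; exact: measurable_partial. Qed.

Lemma measurable_dsum_le0 q : measurable [set w | (dsum q w <= 0)%R].
Proof.
have := measurable_dsum q measurableT (measurable_itv `]-oo, 0]).
by rewrite setTI; congr measurable; apply/seteqP; split => w /=; rewrite in_itv.
Qed.

Lemma measurable_expR_dsum q t :
  measurable_fun setT (fun w => (expR (t * dsum q w))%:E).
Proof.
apply/measurable_EFinP; apply: measurableT_comp => //.
by apply: measurable_funM => //; exact: measurable_dsum.
Qed.

Definition dsum_mgf q t : R := fine (\int[P]_w (expR (t * dsum q w))%:E).

Lemma dsum_mgfE q t : 0 < q < 1 ->
  (\int[P]_w (expR (t * dsum q w))%:E = (dsum_mgf q t)%:E)%E.
Proof.
move=> q01; rewrite /dsum_mgf fineK//.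
have [int _] := discounted_mgf mx x_indep x_mgf t q01.
exact: integrable_fin_num.
Qed.

(** The logarithm of the limiting product is the geometric Riemann sum divided by [y], taken to
    infinitely many cells, where q^n t tends to 0 and G(0) = 0. The error, of order [y], becomes a
    constant after the division. *)
Lemma dsum_mgf_bounds y t : 0 < y < 1 -> t < 0 ->
  expR (G t / y) <= dsum_mgf (1 - y) t <= expR (G t / y + - t * (g 0 - g t)).
Proof.
move=> /andP[y0 y1] t0.
have q01 : 0 < 1 - y < 1 by rewrite subr_gt0 y1 gtrBl.
set q := 1 - y in q01 *; have /andP[q0 q1] := q01.
have yE : y = 1 - q by rewrite /q opprB addrC subrK.
have [_ ] := discounted_mgf mx x_indep x_mgf t q01.
rewrite dsum_mgfE// => /fine_cvgP[_]; set pr := fine \o _ => cv.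
have prE n : pr n = expR (\sum_(m < n) q ^+ m * t * g (q ^+ m * t)).
  by rewrite /pr /= expR_sum big_mkord.
have qn : q ^+ n * t @[n --> \oo] --> 0.
  rewrite -[X in _ --> X](mul0r t); apply: cvgM; last exact: cvg_cst.
  by apply: cvg_expr; rewrite ger0_norm// ltW.
have Gqn : G t - G (q ^+ n * t) @[n --> \oo] --> G t.
  rewrite -[X in _ --> X]subr0; apply: cvgB; first exact: cvg_cst.
  rewrite -[X in _ --> X](oriented_integral0 g).
  apply: (@continuous_cvg _ _ _ _ _ _ G); last exact: qn.
  exact: (primitive_continuous (is_derive_oriented_integral g_cont)).
have sum_le n := geometric_riemann_sum g_cont g_nd t0 q01 n.
rewrite -yE in sum_le.
have Gy : (G t - G (q ^+ n * t)) / y @[n --> \oo] --> G t / y.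
  by apply: cvgM; [exact: Gqn|exact: cvg_cst].
apply/andP; split.
  have lo : expR ((G t - G (q ^+ n * t)) / y) @[n --> \oo] --> expR (G t / y).
    by apply: (@continuous_cvg _ _ _ _ _ _ expR); [exact: continuous_expR|exact: Gy].
  refine (ler_cvg_to lo cv (nearW _ _)).
  move=> n; rewrite prE ler_expR ler_pdivrMr// [leRHS]mulrC.
  by have /andP[] := sum_le n.
have up : expR ((G t - G (q ^+ n * t)) / y + - t * (g 0 - g t)) @[n --> \oo] -->
    expR (G t / y + - t * (g 0 - g t)).
  apply: (@continuous_cvg _ _ _ _ _ _ expR); first exact: continuous_expR.
  by apply: cvgD; [exact: Gy|exact: cvg_cst].
refine (ler_cvg_to cv up (nearW _ _)).
move=> n; rewrite prE ler_expR -(ler_pM2l y0).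
have /andP[_ /le_trans] := sum_le n; apply.
rewrite [leRHS]mulrDr [y * (_ / y)]mulrC divfK ?gt_eqF// lerD2l -mulrA.
rewrite ler_wpM2l ?(ltW y0)// ler_wpM2l ?oppr_ge0 ?(ltW t0)//.
rewrite lerD2r; apply: g_nd.
by rewrite pmulr_rle0 ?(ltW t0)// exprn_gt0.
Qed.

Lemma dsum_chernoff q t : 0 < q < 1 -> t <= 0 ->
  (P [set w | (dsum q w <= 0)%R] <= (dsum_mgf q t)%:E)%E.
Proof.
move=> q01 t0; rewrite -dsum_mgfE//.
rewrite -[X in P X]setIT -integral_indic//; last exact: measurable_dsum_le0.
apply: ge0_le_integral => //.
- by apply/measurable_EFinP; apply: measurable_indic; exact: measurable_dsum_le0.
- exact: measurable_expR_dsum.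
move=> w _; rewrite lee_fin indicE; have [|_] := boolP (w \in _).
  rewrite inE/= => Yw; rewrite -expR0 ler_expR.
  by rewrite -mulrNN mulr_ge0 ?oppr_ge0.
by rewrite expR_ge0.
Qed.

(** For y > 0 one has e^(ty) <= e^(ts y) because t < ts; for y < - b one has e^(ty) = e^((t-s)y)
    e^(sy) <= e^(-(t-s)b) e^(sy); on the window [- b, 0] one has e^(ty) <= e^(-tb). Multiplying by
    e^(tb) normalizes the window to its indicator. *)
Lemma dsum_tilted q s t b : 0 < q < 1 -> s < t -> t < ts -> 0 < b ->
  expR (t * b) * (dsum_mgf q t - dsum_mgf q ts
                  - expR (- ((t - s) * b)) * dsum_mgf q s)
  <= fine (P [set w | (dsum q w <= 0)%R]).
Proof.
move=> q01 st tts b0.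
pose c := expR (- ((t - s) * b)).
have c0 : 0 <= c by exact: expR_ge0.
have mY := measurable_dsum_le0 q.
have E0 u w : (0 <= (expR (u * dsum q w))%:E)%E by rewrite lee_fin expR_ge0.
have me := measurable_expR_dsum q.
have m1 : measurable_fun setT (fun w => (\1_[set w | (dsum q w <= 0)%R] w)%:E : \bar R).
  exact/measurable_EFinP/measurable_indic.
have le : (\int[P]_w ((expR (t * b))%:E * (expR (t * dsum q w))%:E) <=
    \int[P]_w ((\1_[set w | (dsum q w <= 0)%R] w)%:E + (expR (t * b))%:E *
      ((expR (ts * dsum q w))%:E + c%:E * (expR (s * dsum q w))%:E)))%E.
  apply: ge0_le_integral => //.
  - exact: emeasurable_funM.
  - apply: emeasurable_funD => //; apply: emeasurable_funM => //.
    by apply: emeasurable_funD => //; exact: emeasurable_funM.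
  move=> w _; set y := dsum q w.
  have : expR (t * b) * expR (t * y) <= \1_[set w | (dsum q w <= 0)%R] w +
      expR (t * b) * (expR (ts * y) + c * expR (s * y)).
    have B0 := expR_ge0 (t * b).
    have Es := expR_ge0 (s * y); have Ets := expR_ge0 (ts * y).
    rewrite indicE; have [|] := boolP (w \in _).
      rewrite inE/= -/y => y0; have [yb|yb] := leP (- b) y.
        rewrite -[leLHS]addr0 lerD//; last first.
          by rewrite mulr_ge0// addr_ge0// mulr_ge0.
        rewrite -expRD -expR0 ler_expR -mulrDr nmulr_rle0.
          by rewrite -lerBlDl sub0r.
        exact: lt_trans ts_lt0.
      rewrite -[leLHS]add0r lerD// ler_wpM2l//.
      rewrite -[leLHS]add0r lerD// /c -expRD ler_expR.
      have : (t - s) * y <= (t - s) * - b by rewrite ler_pM2l ?subr_gt0// ltW.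
      lra.
    rewrite notin_setE/= -/y => /negP; rewrite -ltNge => y0.
    rewrite add0r ler_wpM2l// -[leLHS]addr0 lerD//; last exact: mulr_ge0.
    by rewrite ler_expR ler_pM2r// ltW.
  by rewrite -lee_fin.
have pE : P [set w | (dsum q w <= 0)%R] = (fine (P [set w | (dsum q w <= 0)%R]))%:E.
  by rewrite fineK//; exact: fin_num_measure.
set p := fine _ in pE *.
have iE : (\int[P]_w (\1_[set w | (dsum q w <= 0)%R] w)%:E = p%:E)%E.
  by rewrite integral_indic// setIT; exact: pE.
have ms : measurable_fun setT (fun w => (c%:E * (expR (s * dsum q w))%:E)%E).
  exact: emeasurable_funM.
have mS : measurable_fun setT
    (fun w => ((expR (ts * dsum q w))%:E + c%:E * (expR (s * dsum q w))%:E)%E).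
  exact: emeasurable_funD.
have mT : measurable_fun setT (fun w => ((expR (t * b))%:E *
    ((expR (ts * dsum q w))%:E + c%:E * (expR (s * dsum q w))%:E))%E).
  exact: emeasurable_funM.
have s0 w : [set: Omega] w -> (0 <= c%:E * (expR (s * dsum q w))%:E)%E.
  by move=> _; apply: mule_ge0.
have S0 w : [set: Omega] w ->
    (0 <= (expR (ts * dsum q w))%:E + c%:E * (expR (s * dsum q w))%:E)%E.
  by move=> _; apply: adde_ge0 => //; exact: s0.
have T0 w : [set: Omega] w -> (0 <= (expR (t * b))%:E *
    ((expR (ts * dsum q w))%:E + c%:E * (expR (s * dsum q w))%:E))%E.
  by move=> _; apply: mule_ge0; [rewrite lee_fin expR_ge0|exact: S0].
move: le; rewrite ge0_integralZl ?lee_fin ?expR_ge0//.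
rewrite ge0_integralD// ge0_integralZl ?lee_fin ?expR_ge0//.
rewrite ge0_integralD// ge0_integralZl ?lee_fin//.
rewrite !dsum_mgfE// iE => le.
have {}le : expR (t * b) * dsum_mgf q t <=
    p + expR (t * b) * (dsum_mgf q ts + c * dsum_mgf q s) by rewrite -lee_fin.
by rewrite -/c -addrA -opprD mulrBr lerBlDr.
Qed.

Lemma discounted_rate :
  (y%:E * lne (P [set w | (y * dsum (1 - y) w <= 0)%R]))%E @[y --> 0^'+]
    --> (G ts)%:E.
Proof.
pose p y := fine (P [set w | (dsum (1 - y) w <= 0)%R]).
have pE (y : R) : 0 < y -> P [set w | (y * dsum (1 - y) w <= 0)%R] = (p y)%:E.
  move=> y0; rewrite /p fineK.
    by congr (P _); apply/seteqP; split => w /=; rewrite pmulr_rle0.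
  by apply: fin_num_measure; exact: measurable_dsum_le0.
have q01 (y : R) : 0 < y < 1 -> 0 < 1 - y < 1.
  by move=> /andP[y0 y1]; rewrite subr_gt0 y1 gtrBl.
have lim : (y%:E * lne (p y)%:E)%E @[y --> 0^'+] --> (G ts)%:E.
  apply: (rate_limit g_cont g_nd ts_lt0 g_ts g_neg
    (p := p) (E := fun y => dsum_mgf (1 - y))).
  - by move=> y t; exact: dsum_mgf_bounds.
  - move=> y y01; rewrite -lee_fin fineK.
      by apply: dsum_chernoff; [exact: q01|exact: ltW].
    by apply: fin_num_measure; exact: measurable_dsum_le0.
  - by move=> y s t b y01; apply: dsum_tilted; exact: q01.
apply: cvg_trans lim; apply: near_eq_cvg; near=> y; rewrite pE//.
Unshelve. all: by end_near. Qed.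

End discounted_rate.

(** * Cumulant generating function of a random variable *)

(** A second-order Taylor bound whose remainder is t^2 times a function of [y] alone, with finite
    expectation; integrating it replaces differentiation under the integral. The remainder u^2 e^|u|
    is handled with |u| <= |y|, y^2 <= 2 e^|y| and e^(2|y|) <= e^(2y) + e^(-2y). *)
Lemma expR_le_quadratic (R : realType) (t y : R) : `|t| <= 1 ->
  expR (t * y) <= 1 + t * y + t ^+ 2 * (2 * (expR (2 * y) + expR (- 2 * y))).
Proof.
move=> t1; set u := t * y.
have step0 : expR u - 1 <= u * expR u.
  have := expR_ge1Dx (- u); rewrite expRN.
  rewrite -(ler_pM2l (expR_gt0 u)) divff ?gt_eqF ?expR_gt0//.
  by rewrite mulrDr mulr1; lra.
have step1 : expR u - 1 - u <= u * (expR u - 1) by lra.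
have step2 : u * (expR u - 1) <= u ^+ 2 * expR `|u|.
  have [u0|u0] := leP 0 u.
    by rewrite ger0_norm// expr2 -mulrA; exact: ler_wpM2l.
  apply: (@le_trans _ _ (u ^+ 2)).
    rewrite expr2 ler_nM2l//; have := expR_ge1Dx u; lra.
  by rewrite ler_peMr ?sqr_ge0// -expR0 ler_expR.
have uy : `|u| <= `|y| by rewrite normrM ler_piMl.
have step3 : y ^+ 2 <= 2 * expR `|y|.
  have := expR_ge1Dxn 1 (normr_ge0 y); rewrite real_normK ?num_real//.
  rewrite (_ : 2`!%:R = 2)//; lra.
have step4 : expR `|y| * expR `|y| <= expR (2 * y) + expR (- 2 * y).
  rewrite -expRD; have [y0|y0] := leP 0 y.
    by rewrite ger0_norm// (_ : y + y = 2 * y) ?lerDl ?expR_ge0//; ring.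
  by rewrite ltr0_norm// (_ : - y - y = - 2 * y) ?lerDr ?expR_ge0//; ring.
have step5 : u ^+ 2 * expR `|u| <= t ^+ 2 * (2 * (expR (2 * y) + expR (- 2 * y))).
  rewrite /u exprMn -mulrA ler_wpM2l ?sqr_ge0//.
  apply: (@le_trans _ _ (2 * expR `|y| * expR `|y|)).
    by apply: ler_pM; rewrite ?sqr_ge0 ?expR_ge0// ler_expR.
  by rewrite -mulrA ler_pM2l.
by move: step1 step2 step5; lra.
Qed.

Section cumulant_generating_function.
Context {R : realType} {d : measure_display} {Omega : measurableType d}.
Context (P : probability Omega R) (x : Omega -> R).
Context (mx : measurable_fun setT x)
        (ix : P.-integrable setT (EFin \o x))
        (x_fin : forall t, (\int[P]_w (expR (t * x w))%:E < +oo)%E).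

Local Notation E u := (\int[P]_w u w).
Local Notation M t := (\int[P]_w expR (t * x w)).
Local Notation mean := (\int[P]_w x w).
Local Notation Lam t := (ln (\int[P]_w expR (t * x w))).

Let intg_exp t : P.-integrable setT (EFin \o (fun w => expR (t * x w))).
Proof.
apply/integrableP; split.
  by apply/measurable_EFinP; apply: measurableT_comp => //; exact: measurable_funM.
under eq_integral => w _ do rewrite /= ger0_norm ?expR_ge0//.
exact: x_fin.
Qed.

Let intg_cst c : P.-integrable setT (EFin \o (fun=> c) : Omega -> \bar R).
Proof. exact: finite_measure_integrable_cst. Qed.

Let intgZ c u : P.-integrable setT (EFin \o u) ->
  P.-integrable setT (EFin \o (fun w => c * u w)).
Proof. exact: integrableZl. Qed.

Let intgD u v : P.-integrable setT (EFin \o u) -> P.-integrable setT (EFin \o v) ->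
  P.-integrable setT (EFin \o (fun w => u w + v w)).
Proof. exact: integrableD. Qed.

Let E_cst (c : R) : \int[P]_w c = c.
Proof.
rewrite Rintegral_cst// -[RHS]mulr1; congr (_ * _).
exact: (congr1 fine (probability_setT P)).
Qed.

Lemma integrable_affine a b :
  P.-integrable setT (EFin \o (fun w => a + b * x w)).
Proof. by apply: intgD => //; exact: intgZ. Qed.

Lemma mean_affine a b : \int[P]_w (a + b * x w) = a + b * mean.
Proof. by rewrite RintegralD ?RintegralZl ?E_cst//; exact: intgZ. Qed.

(** Jensen's inequality, by integrating the tangent line of exp at the mean. *)
Lemma mgf_ge_exp_mean t : expR (t * mean) <= M t.
Proof.
set e := expR (t * mean).
have -> : e = \int[P]_w (e * (1 - t * mean) + e * t * x w).
  by rewrite mean_affine; ring.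
apply: le_Rintegral => //; first exact: integrable_affine.
move=> w _.
have -> : expR (t * x w) = e * expR (t * x w - t * mean).
  by rewrite -expRD addrC subrK.
have := expR_ge1Dx (t * x w - t * mean).
by rewrite -(ler_pM2l (expR_gt0 (t * mean))) -/e; lra.
Qed.

Lemma mgf_gt0 t : 0 < M t.
Proof. exact: lt_le_trans (expR_gt0 _) (mgf_ge_exp_mean t). Qed.

Lemma expR_cgf t : expR (Lam t) = M t.
Proof. by rewrite lnK// posrE mgf_gt0. Qed.

Lemma cgf_ge t : mean * t <= Lam t.
Proof. by rewrite -ler_expR expR_cgf mulrC mgf_ge_exp_mean. Qed.

(** The normalized exponentials e^(s x - Lambda(s)) and e^(t x - Lambda(t)) both have expectation 1,
    so integrating the pointwise convexity of exp between their exponents gives the claim, as in the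
    proof of Hölder's inequality. *)
Lemma cgf_convex (a s t : R) : 0 <= a <= 1 ->
  Lam (a * s + (1 - a) * t) <= a * Lam s + (1 - a) * Lam t.
Proof.
move=> a01.
have alg (e p q m n : R) : p * m = 1 -> q * n = 1 ->
    e * a * p * m + e * (1 - a) * q * n = e.
  move=> pm qn; transitivity (e * a * (p * m) + e * (1 - a) * (q * n)).
    by ring.
  by rewrite pm qn; ring.
have Ms : expR (- Lam s) * M s = 1 by rewrite -[X in _ * X]expR_cgf -expRD addNr expR0.
have Mt : expR (- Lam t) * M t = 1 by rewrite -[X in _ * X]expR_cgf -expRD addNr expR0.
move: Ms Mt; move: (Lam s) (Lam t) => Ls Lt Ms Mt.
set c := a * Ls + _; set v := a * s + _.
rewrite -ler_expR expR_cgf.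
pose k1 := expR c * a * expR (- Ls); pose k2 := expR c * (1 - a) * expR (- Lt).
have Ek : \int[P]_w (k1 * expR (s * x w) + k2 * expR (t * x w)) = expR c.
  rewrite (RintegralD measurableT (intgZ k1 (intg_exp s)) (intgZ k2 (intg_exp t))).
  rewrite (RintegralZl k1 measurableT (intg_exp s)).
  rewrite (RintegralZl k2 measurableT (intg_exp t)).
  exact: alg.
rewrite -Ek; apply: le_Rintegral => //.
  by apply: intgD; exact: intgZ.
move=> w _.
have := expR_convex (s * x w - Ls) (t * x w - Lt) a01.
rewrite -(ler_pM2l (expR_gt0 c)) -expRD.
rewrite (_ : c + _ = v * x w); last by rewrite /c /v; ring.
have -> : expR c * (a * expR (s * x w - Ls) + (1 - a) * expR (t * x w - Lt)) =
    k1 * expR (s * x w) + k2 * expR (t * x w) 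
    by rewrite (expRD (s * x w)) (expRD (t * x w)) /k1 /k2; ring.
by [].
Qed.

Lemma cgf_le t : `|t| <= 1 ->
  Lam t <= mean * t + 2 * (M 2 + M (- 2)) * t ^+ 2.
Proof.
move=> t1.
have Mt : M t <= 1 + t * mean + t ^+ 2 * 2 * (M 2 + M (- 2)).
  have i2 : P.-integrable setT
      (EFin \o (fun w => expR (2 * x w) + expR (- 2 * x w))) by exact: intgD.
  rewrite -mean_affine -(RintegralD measurableT (intg_exp 2) (intg_exp (- 2))).
  rewrite -RintegralZl// -RintegralD//; last 2 first.
  - exact: integrable_affine.
  - exact: intgZ.
  apply: le_Rintegral => //.
    by apply: intgD; [exact: integrable_affine|exact: intgZ].
  by move=> w _; have := expR_le_quadratic (x w) t1; lra.
have M0 := mgf_gt0 t.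
have lnM : Lam t <= M t - 1.
  by rewrite -{1}[M t](subrK 1) addrC le_ln1Dx// ltrBrDl subrr.
apply: (le_trans lnM); move: Mt; move: (M t) (M 2) (M (- 2)) mean => m0 m1 m2 m.
by lra.
Qed.

Lemma cgf_pos : (0 < \int[P]_w (Num.max (- x w) 0)%:E)%E ->
  exists2 t, t < 0 & 0 < Lam t.
Proof.
have max_le s w : 0 < s -> s * Num.max (- x w) 0 <= expR (- s * x w).
  move=> s0; have [x0|x0] := leP (- x w) 0; first by rewrite mulr0 expR_ge0.
  by have := expR_ge1Dx (- s * x w); lra.
have mm : measurable_fun setT (fun w => Num.max (- x w) 0).
  by apply: measurable_maxr => //; exact: measurableT_comp.
have im : P.-integrable setT (EFin \o (fun w => Num.max (- x w) 0)).
  apply: (le_integrable measurableT _ _ (intg_exp (- 1))).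
    exact/measurable_EFinP.
  move=> w _ /=; rewrite lee_fin ger0_norm ?le_max ?lexx ?orbT//.
  rewrite ger0_norm ?expR_ge0//.
  by have := max_le 1 w ltr01; rewrite mul1r.
set b := \int[P]_w Num.max (- x w) 0 => b0.
have {}b0 : 0 < b.
  by rewrite -lte_fin /b /Rintegral fineK//; exact: integrable_fin_num im.
(* The bound s max(- x, 0) <= e^(- s x) has expectation s b on the left; s = 2 / b makes the moment
   generating function at least 2. *)
exists (- (2 / b)); first by rewrite oppr_lt0 divr_gt0.
apply: ln_gt0; apply: (@lt_le_trans _ _ 2); first by rewrite (ltr_nat _ 1 2).
rewrite [leLHS](_ : 2 = 2 / b * b); last by rewrite divfK// gt_eqF.
rewrite -(RintegralZl (2 / b) measurableT im).
apply: le_Rintegral => //; first exact: intgZ.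
by move=> w _; apply: max_le; rewrite divr_gt0.
Qed.

End cumulant_generating_function.

(** * Log-likelihood ratios *)

(** The integral is the difference of those of the positive and negative parts, so it is finite only
    if both are. This turns the finiteness of divergences into integrability. *)
Lemma fin_num_integrable (R : realType) (d : measure_display)
    (T : measurableType d) (mu : {measure set T -> \bar R}) (u : T -> R) :
  measurable_fun setT u -> (\int[mu]_v (u v)%:E)%E \is a fin_num ->
  mu.-integrable setT (EFin \o u).
Proof.
move=> mu_ fin; apply/integrableP; split; first exact/measurable_EFinP.
move: fin; rewrite integralE fin_numB => /andP[posfin negfin].
have mE : measurable_fun setT (EFin \o u) by exact/measurable_EFinP.
rewrite (_ : (fun v => `|_|)%E = (fun v => (EFin \o u)^\+ v + (EFin \o u)^\- v)%E).
  rewrite ge0_integralD//; last 2 first.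
  - exact: measurable_funepos.
  - exact: measurable_funeneg.
  by rewrite lte_add_pinfty// ltey_eq ?posfin ?negfin.
by rewrite -[LHS]/(abse \o (EFin \o u)) fune_abse.
Qed.

(** * From densities to the laws of the signals *)

Section density_transfer.
Context {R : realType} {d d' : measure_display}.
Context {T : measurableType d} {Omega : measurableType d'}.
Context (mu : {measure set T -> \bar R}) (f : T -> R).
Context (P : probability Omega R) (xi : Omega -> T).
Context (f_density : is_density mu f) (mxi : measurable_fun setT xi)
        (xi_law : forall B, measurable B ->
           P (xi @^-1` B) = (\int[mu]_(v in B) (f v)%:E)%E).

Lemma ge0_density_transfer (h : T -> R) :
  measurable_fun setT h -> (forall v, 0 <= h v) ->
  (\int[P]_w (h (xi w))%:E = \int[mu]_v (h v * f v)%:E)%E.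
Proof.
move=> mh h0; have [mf f0 _] := f_density.
transitivity (\int[P]_w ((h (xi w))%:E * (cst 1 w)%:E))%E.
  by apply: eq_integral => w _; rewrite mule1.
apply: (@ge0_eq_weighted_integral R d' d d Omega T T P mu xi id (cst 1) f
  (EFin \o h)) => //; last exact/measurable_EFinP.
move=> B mB; transitivity (P (xi @^-1` B)).
  under eq_integral do rewrite mule1.
  have mxB : measurable (xi @^-1` B).
    by rewrite -[X in measurable X]setTI; exact: mxi.
  by rewrite -[X in _ = P X]setIT -integral_indic.
rewrite xi_law// integral_mkcond; apply: eq_integral => v _.
by rewrite patchE indicE; case: ifPn => _; rewrite ?mul1e ?mul0e.
Qed.

Lemma density_transfer (u : T -> R) : measurable_fun setT u ->
  mu.-integrable setT (EFin \o (fun v => u v * f v)) ->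
  P.-integrable setT (EFin \o (u \o xi)) /\
  (\int[P]_w (u (xi w))%:E = \int[mu]_v (u v * f v)%:E)%E.
Proof.
move=> mu_ iu; have [mf f0 _] := f_density.
split.
  apply/integrableP; split.
    by apply/measurable_EFinP; exact: measurableT_comp.
  rewrite [ltLHS](_ : _ = \int[P]_w (`|u (xi w)|)%:E)%E//.
  rewrite (ge0_density_transfer (h := fun v => `|u v|))//; last first.
    exact: measurableT_comp.
  have /integrableP[_] := iu.
  rewrite (eq_integral (fun v => (`|u v| * f v)%:E))//.
  by move=> v _ /=; rewrite normrM (ger0_norm (f0 v)).
rewrite [LHS]integralE [RHS]integralE; congr (_ - _)%E.
- rewrite (eq_integral (fun w => (Num.max (u (xi w)) 0)%:E)); last first.
    by move=> w _; rewrite funeposE EFin_max.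
  rewrite (ge0_density_transfer (h := fun v => Num.max (u v) 0)).
  + apply: eq_integral => v _.
    by rewrite funeposE -EFin_max maxr_pMl// mul0r.
  + exact: measurable_maxr.
  + by move=> v; rewrite le_max lexx orbT.
- rewrite (eq_integral (fun w => (Num.max (- u (xi w)) 0)%:E)); last first.
    by move=> w _; rewrite funenegE EFin_max.
  rewrite (ge0_density_transfer (h := fun v => Num.max (- u v) 0)).
  + apply: eq_integral => v _.
    by rewrite funenegE -EFinN -EFin_max maxr_pMl// mul0r mulNr.
  + by apply: measurable_maxr => //; exact: measurableT_comp.
  + by move=> v; rewrite le_max lexx orbT.
Qed.

Section log_likelihood_ratio.
Context (L1 L2 : T -> R) (X : set T).
Context (L1_density : is_density mu L1) (L2_density : is_density mu L2)
        (f_support : has_support mu f X) (L1_support : has_support mu L1 X)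
        (L2_support : has_support mu L2 X)
        (KL1_fin : KL mu f L1 \is a fin_num)
        (KL2_fin : KL mu f L2 \is a fin_num)
        (KL_lt : (KL mu f L1 < KL mu f L2)%E).

Local Notation llr := (fun v => ln (L1 v / L2 v)).

Lemma measurable_ln_ratio (g1 g2 : T -> R) : measurable_fun setT g1 ->
  measurable_fun setT g2 -> (forall v, 0 <= g2 v) ->
  measurable_fun setT (fun v => ln (g1 v / g2 v)).
Proof.
move=> m1 m2 g20; apply: measurableT_comp; first exact: measurable_ln.
under eq_fun do rewrite -powR_inv1//.
apply: measurable_funM => //.
exact: (measurableT_comp (@measurable_powR R (- 1)) m2).
Qed.

Lemma ae_supports : \forall v \ae mu,
  [/\ X v <-> 0 < f v, X v <-> 0 < L1 v & X v <-> 0 < L2 v].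
Proof.
move: f_support L1_support L2_support; rewrite /has_support.
by apply: filterS3 => v.
Qed.

Lemma expect_llr_gt0 : (0 < expect mu f llr)%E /\ expect mu f llr \is a fin_num.
Proof.
have [mf f0 _] := f_density; have [mL1 L10 _] := L1_density.
have [mL2 L20 _] := L2_density.
have m1 : measurable_fun setT (fun v => ln (f v / L1 v) * f v).
  by apply: measurable_funM => //; exact: measurable_ln_ratio.
have m2 : measurable_fun setT (fun v => ln (f v / L2 v) * f v).
  by apply: measurable_funM => //; exact: measurable_ln_ratio.
have i1 := fin_num_integrable m1 KL1_fin.
have i2 := fin_num_integrable m2 KL2_fin.
(* Where f > 0, the common support makes both likelihoods positive and the logarithms split; where f
   = 0, all integrands vanish. *)
have -> : expect mu f llr = (KL mu f L2 - KL mu f L1)%E.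
  rewrite /KL /expect -(integralB measurableT i2 i1).
  apply: ae_eq_integral => //.
  - apply/measurable_EFinP; apply: measurable_funM => //.
    exact: measurable_ln_ratio.
  - by apply: emeasurable_funB; exact/measurable_EFinP.
  apply: filterS ae_supports => v [Xf X1 X2] _ /=.
  rewrite -EFinB -mulrBl.
  have [fv|] := ltP 0 (f v); last first.
    by move=> fv; rewrite (le_anti (introT andP (conj fv (f0 v)))) !mulr0.
  have Xv : X v by exact/Xf.
  have /X1 l1 := Xv; have /X2 l2 := Xv.
  by rewrite !ln_div ?posrE//; congr (_ * _)%:E; ring.
split; last by rewrite fin_numB KL1_fin KL2_fin.
by rewrite sube_gt0.
Qed.

Lemma measurable_llr : measurable_fun setT llr.
Proof.
have [m1 _ _] := L1_density; have [m2 p2 _] := L2_density.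
exact: measurable_ln_ratio.
Qed.

Lemma llr_transfer : P.-integrable setT (EFin \o (llr \o xi)) /\
  (\int[P]_w (llr (xi w))%:E = expect mu f llr)%E.
Proof.
have [mf _ _] := f_density; have [_ fin] := expect_llr_gt0.
apply: density_transfer; first exact: measurable_llr.
apply: fin_num_integrable => //.
by apply: measurable_funM => //; exact: measurable_llr.
Qed.

(* [L1] and [L2] have the same mass, so [L1 >= L2] would force [L1 = L2]. *)
Lemma llr_neg : (0 < \int[P]_w (Num.max (- llr (xi w)) 0)%:E)%E.
Proof.
have [mf f0 _] := f_density; have [mL1 L10 I1] := L1_density.
have [mL2 L20 I2] := L2_density.
have mllr := measurable_llr.
have mmax : measurable_fun setT (fun v => Num.max (- llr v) 0).
  by apply: measurable_maxr => //; exact: measurableT_comp.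
rewrite lt0e; apply/andP; split; last first.
  by apply: integral_ge0 => w _; rewrite lee_fin le_max lexx orbT.
apply/eqP; rewrite (ge0_density_transfer (h := fun v => Num.max (- llr v) 0))//;
  last by move=> v; rewrite le_max lexx orbT.
set u := fun v => (Num.max (- llr v) 0 * f v)%:E => I0.
have mu_ : measurable_fun setT u.
  by apply/measurable_EFinP; exact: measurable_funM.
have u0 v : (0 <= u v)%E.
  by rewrite lee_fin mulr_ge0// le_max lexx orbT.
have ae0 : ae_eq mu setT u (cst 0%E).
  apply/ae_eq_integral_abs => //; rewrite -[RHS]I0; apply: eq_integral => v _.
  by rewrite gee0_abs.
(* A vanishing negative part means llr >= 0 wherever f > 0, that is L1 >= L2 on the common support;
   off the support L2 is 0. *)
have ae_le : \forall v \ae mu, L2 v <= L1 v.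
  apply: filterS2 ae_supports ae0 => v [Xf X1 X2] /(_ I) [] uv.
  have [Xv|nXv] := pselect (X v); last first.
    have -> : L2 v = 0 by apply/eqP; rewrite eq_le L20 andbT leNgt; apply/negP => /X2.
    exact: L10.
  have /Xf fv := Xv; have /X1 l1 := Xv; have /X2 l2 := Xv.
  have llr0 : 0 <= ln (L1 v / L2 v).
    move/eqP: uv; rewrite mulf_eq0 (gt_eqF fv) orbF => /eqP mx.
    by rewrite -oppr_le0 -mx le_max lexx.
  rewrite leNgt; apply/negP => lt.
  have : ln (L1 v / L2 v) < 0 by rewrite ln_lt0// divr_gt0//= ltr_pdivrMr// mul1r.
  by rewrite ltNge llr0.
have mD : measurable_fun setT (fun v => (L1 v - L2 v)%:E).
  by apply/measurable_EFinP; exact: measurable_funB.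
have iL (g : T -> R) : is_density mu g -> mu.-integrable setT (EFin \o g).
  by move=> [mg _ Ig]; apply: fin_num_integrable; rewrite ?Ig.
have ID : (\int[mu]_v `|(L1 v - L2 v)%:E| = 0)%E.
  transitivity (\int[mu]_v ((EFin \o L1) v - (EFin \o L2) v))%E.
    apply: ae_eq_integral => //.
    - exact: measurableT_comp.
    by apply: filterS ae_le => v lev _ /=; rewrite ger0_norm ?subr_ge0.
  rewrite integralB//; [|exact: iL|exact: iL].
  by rewrite [X in (X - _)%E]I1 [X in (_ - X)%E]I2 subee.
have aeE : ae_eq mu setT (fun v => (L1 v - L2 v)%:E) (cst 0%E).
  exact/ae_eq_integral_abs.
(* Equality of the likelihoods almost everywhere would give a zero mean, which the strict inequality
   of the divergences excludes. *)
have : expect mu f llr = 0%E.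
  rewrite /expect (ae_eq_integral (cst 0%E)) ?integral0//.
  - by apply/measurable_EFinP; exact: measurable_funM.
  apply: filterS2 ae_supports aeE => v [Xf X1 X2] /(_ I) [] /eqP.
  rewrite subr_eq0 => /eqP L12 _ /=; rewrite L12.
  have [fv|fv] := ltP 0 (f v); last first.
    by rewrite (le_anti (introT andP (conj fv (f0 v)))) mulr0.
  have Xv : X v by exact/Xf.
  have /X2 l2 := Xv.
  by rewrite divff ?gt_eqF// ln1 mul0r.
by have [+ _] := expect_llr_gt0 => /[swap] ->; rewrite ltxx.
Qed.

End log_likelihood_ratio.
End density_transfer.

(** * Identical agents *)

Definition rate_shape {R : realType} (g : R -> R) (ts : R) : Prop :=
  [/\ continuous g, {homo g : s t / s <= t}, ts < 0 /\ g ts = 0,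
      forall s, s < ts -> g s < 0 & forall s, ts < s -> 0 < g s].

(** The substitution s -> w_k s is made on the side of derivatives: the sum of the G(w_k t) vanishes
    at 0 and has the derivative [H], the continuous extension of the integrand. *)
Lemma rate_shape_aggregate (R : realType) (Lam : R -> R) (ts : R) (N : nat)
    (w : 'I_N -> R) : Lam 0 = 0 -> rate_shape (quotient_ext Lam) ts ->
    (forall k, 0 < w k) -> forall t,
  oriented_integral (quotient_ext (fun s => \sum_k Lam (w k * s))) 0 t =
  \sum_k oriented_integral (quotient_ext Lam) 0 (w k * t).
Proof.
move=> Lam0 [gc _ _ _ _] w0 t; set g := quotient_ext Lam in gc *.
have LamE s : Lam s = s * g s.
  have [->|s0] := eqVneq s 0; first by rewrite mul0r.
  by rewrite /g quotient_extE// mulrC divfK.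
pose H s := \sum_k w k * g (w k * s).
have Hc : continuous H.
  move=> s; rewrite /H /continuous_at.
  elim: (index_enum _) => [|k r IH].
    by under eq_fun do rewrite big_nil; rewrite big_nil; exact: cvg_cst.
  under eq_fun do rewrite big_cons; rewrite big_cons; apply: cvgD => //.
  apply: cvgM; first exact: cvg_cst.
  apply: (@continuous_cvg _ _ _ _ _ _ g); first exact: gc.
  by apply: cvgM; [exact: cvg_cst|exact: cvg_id].
have ratioE s : s != 0 -> (\sum_k Lam (w k * s)) / s = H s.
  move=> s0; rewrite mulr_suml; apply: eq_bigr => k _.
  by rewrite LamE mulrAC mulfK// mulrC.
have -> : quotient_ext (fun s => \sum_k Lam (w k * s)) = H.
  apply/funext => s; have [->|s0] := eqVneq s 0; last first.
    by rewrite quotient_extE// ratioE.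
  rewrite /quotient_ext eqxx; apply/cvg_lim; first exact: Rhausdorff.
  apply: cvg_trans (cvg_within_filter _ (Hc 0)).
  apply: near_eq_cvg; near=> u; rewrite ratioE//.
  by near: u; exact: nbhs_dnbhs_neq.
have dG (s : R) : is_derive s (1 : R)
    (fun t => \sum_k oriented_integral g 0 (w k * t)) (H s).
  have dk (k : 'I_N) : is_derive s (1 : R)
      (fun t => oriented_integral g 0 (w k * t)) (w k * g (w k * s)).
    have dl : is_derive s (1 : R) (fun t => w k * t) (w k).
      by have := is_deriveZ (w k) (is_derive_id s (1 : R)); rewrite [_ *: _]mulr1.
    have dg := is_derive_oriented_integral gc (w k * s).
    by rewrite mulrC; exact: is_derive1_comp.
  have := is_derive_sum dk.
  by rewrite (_ : (\sum_(k < N) _) = fun t => \sum_k oriented_integral g 0 (w k * t))//;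
    apply/funext => u; rewrite fct_sumE.
rewrite (oriented_integral_FTC Hc dG).
by rewrite [X in _ - X]big1 ?subr0// => k _; rewrite mulr0 oriented_integral0.
Unshelve. all: by end_near. Qed.

Section identical_agents.
Context {R : realType} {d d' : measure_display}.
Context {T : measurableType d} {Omega : measurableType d'}.
Context {N : nat} {Theta : finType} (theta1 : Theta).
Context (mu : {sigma_finite_measure set T -> \bar R}).
Context (X : 'I_N -> set T) (f : 'I_N -> T -> R) (L : 'I_N -> Theta -> T -> R).
Context (P : probability Omega R) (xi : 'I_N -> nat -> {RV P >-> T}).
Context (f_density : forall k, is_density mu (f k))
        (L_density : forall k theta, is_density mu (L k theta))
        (f_support : forall k, has_support mu (f k) (X k))
        (L_support : forall k theta, has_support mu (L k theta) (X k))
        (xi_law : forall k i (B : set T), measurable B ->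
           P (xi k i @^-1` B) = (\int[mu]_(x in B) (f k x)%:E)%E)
        (xi_indep : mutually_independent P
           (fun ki : 'I_N * nat => (xi ki.1 ki.2 : Omega -> T)))
        (KL_finite : forall k theta, KL mu (f k) (L k theta) \is a fin_num)
        (mgf_finite : forall k t theta, theta != theta1 ->
           (mgf mu f L theta1 k t theta < +oo)%E)
        (model_identifiable : identifiable mu f L theta1)
        (identical : forall k j, f k = f j /\ L k = L j).

(** If [theta] did as well as [theta1] for one agent, it would minimize the divergence for all
    agents, since they share one model, and so lie in the intersection that identifiability reduces
    to [theta1]. *)
Lemma KL_true_lt k theta : theta != theta1 ->
  (KL mu (f k) (L k theta1) < KL mu (f k) (L k theta))%E.
Proof.
move=> th1; have [[k0 [_ k0min]] cap] := model_identifiable.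
rewrite ltNge; apply/negP => le.
have : (\bigcap_(j in N_A mu f L theta1) Theta_star mu f L j) theta.
  move=> j _; split => // b _.
  have [-> ->] := identical j k; apply: (le_trans le).
  by have := k0min b I; have [-> ->] := identical k0 k.
by rewrite cap => /= E; rewrite E eqxx in th1.
Qed.

Section agent.
Context (k : 'I_N) (theta : Theta) (theta_neq : theta != theta1).

Local Notation x m := (fun w => llr L theta1 k theta (xi k m w)).
Local Notation Lam := (fun t => Lambda mu f L theta1 k t theta).

Let mxi m : measurable_fun setT (xi k m : Omega -> T).
Proof. exact: measurable_funP. Qed.

Let mllr : measurable_fun setT (llr L theta1 k theta).
Proof. exact: (measurable_llr (L_density k theta1) (L_density k theta)). Qed.

Let mx m : measurable_fun setT (x m).
Proof. exact: measurableT_comp. Qed.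

Lemma mean_llr_gt0 : 0 < mean_llr mu f L theta1 k theta.
Proof.
have [pos fin] := expect_llr_gt0 (f_density k) (L_density k theta1)
  (L_density k theta) (f_support k) (L_support k theta1) (L_support k theta)
  (KL_finite k theta1) (KL_finite k theta) (KL_true_lt k theta_neq).
by rewrite -lte_fin /mean_llr fineK.
Qed.

Let mgfE m t :
  (\int[P]_w (expR (t * llr L theta1 k theta (xi k m w)))%:E =
   mgf mu f L theta1 k t theta)%E.
Proof.
have := @ge0_density_transfer R d d' T Omega mu (f k) P (xi k m) (f_density k)
  (mxi m) (xi_law k m) (fun v => expR (t * llr L theta1 k theta v)).
apply; last by move=> v; exact: expR_ge0.
by apply: measurableT_comp => //; exact: measurable_funM.
Qed.

Let x_fin m t : (\int[P]_w (expR (t * x m w))%:E < +oo)%E.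
Proof. by rewrite mgfE mgf_finite. Qed.

(** The signal of index 0 represents all times, since every [xi k m] has the density [f k]. *)
Let llrP := llr_transfer (f_density k) (mxi 0%N) (xi_law k 0%N)
  (L_density k theta1) (L_density k theta) (f_support k) (L_support k theta1)
  (L_support k theta) (KL_finite k theta1) (KL_finite k theta)
  (KL_true_lt k theta_neq).

Let ix : P.-integrable setT (EFin \o x 0%N).
Proof. exact: llrP.1. Qed.

Let LamE t : Lam t = ln (\int[P]_w expR (t * x 0%N w)).
Proof. by rewrite /Lambda /Rintegral mgfE. Qed.

Let meanE : \int[P]_w x 0%N w = mean_llr mu f L theta1 k theta.
Proof. by rewrite /Rintegral /mean_llr -llrP.2. Qed.

Lemma Lambda_rate_shape :
  Lam 0 = 0 /\ exists ts, rate_shape (quotient_ext Lam) ts.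
Proof.
have conv a s t : 0 <= a <= 1 ->
    Lam (a * s + (1 - a) * t) <= a * Lam s + (1 - a) * Lam t.
  by move=> a01; rewrite !LamE; exact: (cgf_convex (mx 0%N) ix (x_fin 0%N)).
have ge t : mean_llr mu f L theta1 k theta * t <= Lam t.
  by rewrite LamE -meanE; exact: (cgf_ge (mx 0%N) ix (x_fin 0%N)).
pose C := 2 * (\int[P]_w expR (2 * x 0%N w) + \int[P]_w expR (- 2 * x 0%N w)).
have le t : `|t| <= 1 ->
    Lam t <= mean_llr mu f L theta1 k theta * t + C * t ^+ 2.
  by move=> t1; rewrite LamE -meanE; exact: (cgf_le (mx 0%N) ix (x_fin 0%N)).
have C0 : 0 <= C.
  by rewrite mulr_ge0// addr_ge0// Rintegral_ge0// => w _; exact: expR_ge0.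
have pos : exists2 t, t < 0 & 0 < Lam t.
  have [t t0 Lt] := cgf_pos (mx 0%N) (x_fin 0%N) (llr_neg (f_density k)
    (mxi 0%N) (xi_law k 0%N) (L_density k theta1) (L_density k theta)
    (f_support k) (L_support k theta1) (L_support k theta)
    (KL_finite k theta1) (KL_finite k theta) (KL_true_lt k theta_neq)).
  by exists t => //; rewrite LamE.
split; first exact: (cumulant0 ge le).
have [ts [ts0 gts gn gp]] := quotient_ext_sign conv ge le mean_llr_gt0 C0 pos.
exists ts; split => //.
- exact: (quotient_ext_continuous conv ge le C0).
- exact: (quotient_ext_nd conv ge le C0).
Qed.

Lemma Phi_nc_rate ts : rate_shape (quotient_ext Lam) ts ->
  Phi_nc L theta1 xi k theta =
  (- oriented_integral (quotient_ext Lam) 0 ts)%:E.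
Proof.
move=> [gc gnd [ts0 gts] gn gp]; have [Lam0 _] := Lambda_rate_shape.
have x_indep : mutually_independent P (fun m => x m).
  move=> s B us mB.
  (* The times of one agent form a subfamily of the pairs (agent, time), and events on the ratios
     are pulled back to events on the signals. *)
  have := xi_indep (s := [seq (k, m) | m <- s])
    (B := fun ki => llr L theta1 k theta @^-1` B ki.2).
  rewrite !bigcap_seq !big_map => -> //.
    by rewrite map_inj_uniq// => a b [].
  by move=> ki; rewrite -[X in measurable X]setTI; exact: mllr.
have x_mgf m t : (\int[P]_w (expR (t * x m w))%:E =
    (expR (t * quotient_ext Lam t))%:E)%E.
  have -> : t * quotient_ext Lam t = Lam t.
    have [->|t_neq0] := eqVneq t 0; first by rewrite mul0r Lam0.
    by rewrite quotient_extE// mulrC divfK.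
  rewrite LamE (expR_cgf (mx 0%N) ix (x_fin 0%N)) /Rintegral mgfE mgfE fineK//.
  rewrite ge0_fin_numE ?mgf_finite// -(mgfE 0%N).
  by apply: integral_ge0 => w _; rewrite lee_fin expR_ge0.
rewrite /Phi_nc EFinN; congr (- _)%E; apply/cvg_lim => //.
exact: (discounted_rate mx x_indep x_mgf gc gnd ts0 gts gn).
Qed.

End agent.

Lemma Phi_theta_aggregate k0 theta ts (pi : 'rV[R]_N) : theta != theta1 ->
  rate_shape (quotient_ext (fun t => Lambda mu f L theta1 k0 t theta)) ts ->
  (forall k, 0 < pi ord0 k) ->
  Phi_theta mu f L theta1 pi theta =
  (- ereal_inf (range (fun t => (\sum_k oriented_integral
     (quotient_ext (fun t => Lambda mu f L theta1 k0 t theta)) 0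
     (pi ord0 k * t))%:E)))%E.
Proof.
move=> th1 shape pi0; have [Lam0 _] := Lambda_rate_shape k0 th1.
have phiE t : phi mu f L theta1 t pi theta = \sum_k oriented_integral
    (quotient_ext (fun t => Lambda mu f L theta1 k0 t theta)) 0 (pi ord0 k * t).
  have aveE : (fun s => Lambda_ave mu f L theta1 s pi theta) =
      (fun s => \sum_k Lambda mu f L theta1 k0 (pi ord0 k * s) theta).
    apply/funext => s; rewrite /Lambda_ave; apply: eq_bigr => k _.
    by rewrite /Lambda /mgf /llr; have [-> ->] := identical k k0.
  rewrite /phi aveE.
  exact: (rate_shape_aggregate (w := fun k => pi ord0 k) Lam0 shape pi0 t).
by rewrite /Phi_theta (funext (fun t => congr1 EFin (phiE t))).
Qed.

Lemma Phi_nc_identical k j theta : theta != theta1 ->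
  Phi_nc L theta1 xi k theta = Phi_nc L theta1 xi j theta.
Proof.
move=> th1; have [_ [ts shape]] := Lambda_rate_shape k th1.
have LamE : (fun t => Lambda mu f L theta1 k t theta) =
            (fun t => Lambda mu f L theta1 j t theta).
  by apply/funext => t; rewrite /Lambda /mgf /llr; have [-> ->] := identical k j.
rewrite (Phi_nc_rate th1 shape).
by move: shape; rewrite LamE => shape; rewrite (Phi_nc_rate th1 shape).
Qed.

Lemma Phi_nc_sum_identical k theta : theta != theta1 ->
  Phi_nc_sum L theta1 xi theta = (N%:R%:E * Phi_nc L theta1 xi k theta)%E.
Proof.
move=> th1; have [_ [ts shape]] := Lambda_rate_shape k th1.
rewrite /Phi_nc_sum (eq_bigr (fun=> Phi_nc L theta1 xi k theta)); last first.
  by move=> j _; exact: Phi_nc_identical.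
by rewrite (Phi_nc_rate th1 shape) sumEFin sumr_const card_ord -EFinM mulr_natl.
Qed.

Lemma Phi_theta_uniform theta (pi : 'rV[R]_N) : theta != theta1 ->
  \sum_k pi ord0 k = 1 -> (forall k, pi ord0 k = N%:R^-1) ->
  Phi_theta mu f L theta1 pi theta = Phi_nc_sum L theta1 xi theta.
Proof.
move=> th1 pi_sum piN; have [[k0 _] _] := model_identifiable.
have N0 : (0 < N)%N by case: (N) k0 => [[]|].
have pi0 k : 0 < pi ord0 k by rewrite piN invr_gt0 ltr0n.
have [_ [ts shape]] := Lambda_rate_shape k0 th1.
have [gc _ [ts0 gts] gn gp] := shape.
rewrite (Phi_theta_aggregate th1 shape pi0).
rewrite (aggregate_inf_uniform gc gn gp pi_sum piN).
by rewrite (Phi_nc_sum_identical k0 th1) (Phi_nc_rate th1 shape) -EFinM mulrN.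
Qed.

Lemma Phi_theta_nonuniform theta (pi : 'rV[R]_N) : theta != theta1 ->
  \sum_k pi ord0 k = 1 -> (forall k, 0 < pi ord0 k) ->
  (exists k, pi ord0 k != N%:R^-1) ->
  (Phi_theta mu f L theta1 pi theta < Phi_nc_sum L theta1 xi theta)%E.
Proof.
move=> th1 pi_sum pi0 piN; have [[k0 _] _] := model_identifiable.
have [_ [ts shape]] := Lambda_rate_shape k0 th1.
have [gc _ [ts0 gts] gn gp] := shape.
rewrite (Phi_theta_aggregate th1 shape pi0).
rewrite (Phi_nc_sum_identical k0 th1) (Phi_nc_rate th1 shape) -EFinM mulrN.
by rewrite EFinN lteN2; exact: (aggregate_inf_nonuniform gc ts0 gn gp pi0 pi_sum piN).
Qed.

End identical_agents.

Theorem corollary1 (R : realType) (d d' : measure_display)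
  (T : measurableType d) (Omega : measurableType d')
  (N : nat) (Theta : finType) (theta1 : Theta)
  (mu : {sigma_finite_measure set T -> \bar R})
  (X : 'I_N -> set T) (f : 'I_N -> T -> R) (L : 'I_N -> Theta -> T -> R)
  (P : probability Omega R) (xi : 'I_N -> nat -> {RV P >-> T})
  (f_density : forall k, is_density mu (f k))
  (L_density : forall k theta, is_density mu (L k theta))
  (f_support : forall k, has_support mu (f k) (X k))
  (L_support : forall k theta, has_support mu (L k theta) (X k))
  (xi_law : forall k i (B : set T), measurable B ->
     P (xi k i @^-1` B) = (\int[mu]_(x in B) (f k x)%:E)%E)
  (xi_indep : mutually_independent P
     (fun ki : 'I_N * nat => (xi ki.1 ki.2 : Omega -> T)))
  (KL_finite : forall k theta, KL mu (f k) (L k theta) \is a fin_num)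
  (mgf_finite : forall k t theta, theta != theta1 ->
     (mgf mu f L theta1 k t theta < +oo)%E)
  (model_identifiable : identifiable mu f L theta1)
  (theta_dagger : Theta)
  (theta_dagger_argmin :
     argmin [set theta | theta != theta1] (Phi_nc_sum L theta1 xi) =
     [set theta_dagger])
  (identical : forall k j, f k = f j /\ L k = L j) :
  [/\ argmax (Pi mu f L theta1) (Phi mu f L theta1) =
        [set const_mx (N%:R^-1)],
      Phi_star mu f L theta1 = Phi_nc_sum L theta1 xi theta_dagger
    & forall k, Phi_nc_sum L theta1 xi theta_dagger =
        (N%:R%:E * Phi_nc L theta1 xi k theta_dagger)%E].
Proof.
have [k0 _] := model_identifiable.1.
(* An element of [N_A] is an agent, so N is positive. *)
have N0 : (0 < N)%N by case: (N) k0 => [[]|].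
have [dag1 dag_min] : argmin [set theta | theta != theta1]
    (Phi_nc_sum L theta1 xi) theta_dagger by rewrite theta_dagger_argmin.
pose u : 'rV[R]_N := const_mx N%:R^-1.
have uE k : u ord0 k = N%:R^-1 by rewrite mxE.
have u_sum : \sum_k u ord0 k = 1.
  under eq_bigr do rewrite uE.
  by rewrite sumr_const card_ord -[LHS]mulr_natr mulVf// pnatr_eq0 -lt0n.
have Pi_u : Pi mu f L theta1 u.
  split => // [k|theta th1]; first by rewrite uE invr_gt0 ltr0n.
  rewrite (bigD1 k0)//= ltr_pwDl// ?sumr_ge0//.
  - by rewrite uE mulr_gt0 ?invr_gt0 ?ltr0n//;
      exact: (mean_llr_gt0 f_density L_density f_support L_support KL_finite
                model_identifiable identical).
  - move=> k _; rewrite uE mulr_ge0 ?invr_ge0 ?ler0n// ltW//.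
    exact: (mean_llr_gt0 f_density L_density f_support L_support KL_finite
                model_identifiable identical).
have Phi_u : Phi mu f L theta1 u = Phi_nc_sum L theta1 xi theta_dagger.
  have thetaE theta : theta != theta1 ->
      Phi_theta mu f L theta1 u theta = Phi_nc_sum L theta1 xi theta.
    by move=> th1; apply: (Phi_theta_uniform f_density L_density f_support
      L_support xi_law xi_indep KL_finite mgf_finite model_identifiable identical).
  rewrite /Phi; apply/eqP; rewrite eq_le; apply/andP; split.
    by rewrite (bigD1 theta_dagger)//= ge_min thetaE// lexx.
  elim/big_ind : _ => [|a b ha hb|theta th1]; first exact: leey.
    by rewrite le_min ha hb.
  by rewrite thetaE//; exact: dag_min.
(* Comparing at theta_dagger alone is enough: Phi(pi) is at most the exponent at theta_dagger, which
   for nonuniform pi is strictly below the sum of the non-cooperative ones, the value of Phi at the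
   uniform vector. *)
have nonuniform pi : Pi mu f L theta1 pi -> pi != u ->
    (Phi mu f L theta1 pi < Phi mu f L theta1 u)%E.
  move=> [pi_sum pi0 _] piu; rewrite Phi_u.
  apply: (@le_lt_trans _ _ (Phi_theta mu f L theta1 pi theta_dagger)).
    by rewrite /Phi (bigD1 theta_dagger)//= ge_min lexx.
  apply: (Phi_theta_nonuniform f_density L_density f_support L_support xi_law
    xi_indep KL_finite mgf_finite model_identifiable identical) => //.
  apply/existsP; apply: contraNT piu; rewrite negb_exists => /forallP H.
  by apply/eqP/rowP => k; rewrite uE; exact/eqP/negPn/H.
have u_max pi : Pi mu f L theta1 pi ->
    (Phi mu f L theta1 pi <= Phi mu f L theta1 u)%E.
  by move=> Ppi; have [->//|piu] := eqVneq pi u; exact/ltW/nonuniform.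
split.
- apply/seteqP; split => [pi [Ppi pimax]|_ ->]; last by split.
  have [//|piu] := eqVneq pi u.
  by have := nonuniform pi Ppi piu; rewrite ltNge pimax.
- rewrite -Phi_u /Phi_star; apply/eqP; rewrite eq_le; apply/andP; split.
    by apply: ge_ereal_sup => _ [pi Ppi <-]; exact: u_max.
  by apply: ereal_sup_ubound; exists u.
- move=> k; exact: (Phi_nc_sum_identical f_density L_density f_support
    L_support xi_law xi_indep KL_finite mgf_finite model_identifiable identical).
Qed.
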